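(* Let $Q$ be a polygon and let $f: \mathbb{N} \to \mathbb{N}$ be any monotonically increasing function such that $\frac{1}{n f(n)}$ is summable (i.e. $\sum_{n\ge1}\frac{1}{n f(n)}<\infty$). Then the upper metric complexity (equivalently, upper slow entropy) of the billiard shift $(\Sigma_Q,\sigma_Q,\bar\mu)$ is at most $n^6 (f(n))^2$.
   Context: A polygon $Q$ is a planar polygon (not assumed convex). The billiard in $Q$ is the free motion of a point particle with unit speed and specular reflections from the boundary, not defined at corners. The billiard map $S$ is the first return map of the billiard flow to $\partial Q$ (not defined for points whose next arrival to the boundary is a vertex). Its phase space $P_Q$ is the set of inward pointing unit vectors $z=(s,\theta)$ with foot point $s\in\partial Q$ (arc length parametrization) and angle $\theta$ with the positive direction of the boundary. The $S$-invariant Liouville measure on $P_Q$ is $d\mu = \sin\theta\, d\theta\, ds$. Label the sides of $Q$ by distinct letters of a finite alphabet $\mathcal{A}$ and code each forward orbit by the sequence of sides it hits. $\Sigma_Q$ is the collection of all infinite codes obtained in $Q$, $\sigma_Q:\Sigma_Q\to\Sigma_Q$ is the left shift, and $\bar\mu$ is the shift-invariant probability measure on $\Sigma_Q$ obtained from the normalized Liouville measure $\mu$ via the coding map $z\mapsto \bar z$. Metric complexity: let $\Sigma$ be a one-sided shift space over a finite alphabet $\mathcal{A}$ with left shift $\sigma$ and $\sigma$-invariant probability measure $\nu$. For $a,b\in\mathcal{A}^k$ let $\bar d(a,b) := \frac1k \#\{i: a_i\neq b_i\}$ (Hamming distance). For $x\in\Sigma$ let $\mathcal{B}(x,n,\varepsilon):=\{y\in\Sigma: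 \bar d(x_{0,n-1},y_{0,n-1})<\varepsilon\}$, where $x_{0,n-1}$ denotes the truncation of $x$ to its first $n$ symbols. Let $P(n,\varepsilon)$ be the smallest number $P$ such that there exists a subset of $\Sigma$ of $\nu$-measure at least $1-\varepsilon$ covered by at most $P$ balls $\mathcal{B}(x,n,\varepsilon)$. For an increasing function $g:\mathbb{N}\to\mathbb{N}$, $(\Sigma,\sigma,\nu)$ has upper metric complexity, or upper slow entropy, at most $g(n)$ if $$\lim_{\varepsilon\to0}\limsup_{n\to\infty}\frac{P(n,\varepsilon)}{g(n)}\le 1.$$ *)

(* Defs.v *)
From HB Require Import structures.
From mathcomp Require Import all_boot all_order all_algebra.
From mathcomp Require Import all_classical all_reals all_analysis.

Set Implicit Arguments.
Unset Strict Implicit.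
Unset Printing Implicit Defensive.

Import Order.TTheory GRing.Theory Num.Theory numFieldNormedType.Exports.
Local Open Scope classical_set_scope.
Local Open Scope ring_scope.

Section PlaneGeometry.
Context {R : realType}.
Local Notation plane := (R^o * R^o)%type.

Definition dot (p q : plane) : R := p.1 * q.1 + p.2 * q.2.
Definition cross (p q : plane) : R := p.1 * q.2 - p.2 * q.1.
Definition rot90 (p : plane) : plane := (- p.2, p.1).

Definition edge n (v : 'I_n -> plane) (i : 'I_n) : plane := v (ordS i) - v i.

Definition closed_side n (v : 'I_n -> plane) (i : 'I_n) : set plane :=
  [set v i + t *: edge v i | t in `[0, 1]].

End PlaneGeometry.

(* A simple closed polygon, not assumed convex.  Side i joins vertex i to
   vertex (ordS i), cyclically.  The corner condition says that every vertex is
   a genuine one (its angle is not pi) and makes adjacent sides meet only at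
   their common vertex.  By the shoelace formula, a positive signed area means
   that the vertices are listed counterclockwise, so that the interior lies to
   the left of every side. *)
Record polygon (R : realType) := Polygon {
  nsides : nat;
  vertex : 'I_nsides -> R^o * R^o;
  nsides_ge3 : (3 <= nsides)%N;
  polygon_corner : forall i : 'I_nsides,
    cross (edge vertex i) (edge vertex (ordS i)) != 0;
  polygon_simple : forall i j : 'I_nsides,
    j != i -> j != ordS i -> i != ordS j ->
    closed_side vertex i `&` closed_side vertex j = set0;
  polygon_ccw : 0 < \sum_(i < nsides) cross (vertex i) (vertex (ordS i))
}.

Arguments vertex {R} p _.

Section Billiard.
Context {R : realType}.
Variable Q : polygon R.
Local Notation plane := (R^o * R^o)%type.
Local Notation side := 'I_(nsides Q).

Definition boundary : set plane := \bigcup_(i : side) closed_side (vertex Q) i.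

Definition side_vector (i : side) : plane := edge (vertex Q) i.
Definition side_length (i : side) : R :=
  Num.sqrt (dot (side_vector i) (side_vector i)).
Definition tangent (i : side) : plane := (side_length i)^-1 *: side_vector i.
Definition inner_normal (i : side) : plane := rot90 (tangent i).

(* Arc length parameter along the boundary, starting at vertex 0. *)
Definition side_start (i : side) : R :=
  \sum_(j < nsides Q | (j < i)%N) side_length j.
Definition on_side (i : side) : set R :=
  `]side_start i, side_start i + side_length i[.
Definition foot (i : side) (s : R) : plane :=
  vertex Q i + (s - side_start i) *: tangent i.
Definition direction (i : side) (theta : R) : plane :=
  cos theta *: tangent i + sin theta *: inner_normal i.

(* Corners, which have measure zero and where the billiard is not defined, are
   left out of the phase space. *)
Definition phase_space : set (R * R) :=
  [set z | (exists i, on_side i z.1) /\ 0 < z.2 < pi].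

Definition reflect_in (j : side) (u : plane) : plane :=
  u - (2 * dot u (inner_normal j)) *: inner_normal j.

(* The graph of the billiard map S: since z points inward, the flow line
   issued from z stays in Q until the first time t > 0 at which it is on the
   boundary; it is then reflected.  There is no z' when that boundary point is
   a vertex. *)
Definition billiard_map (z z' : R * R) : Prop :=
  [/\ phase_space z, phase_space z' &
   exists i j, [/\ on_side i z.1, on_side j z'.1,
     direction j z'.2 = reflect_in j (direction i z.2) &
     exists t : R, [/\ 0 < t,
       foot j z'.1 = foot i z.1 + t *: direction i z.2 &
       forall r : R, 0 < r < t ->
         ~ boundary (foot i z.1 + r *: direction i z.2)]]].

Definition forward_orbit (z : nat -> R * R) : Prop :=
  forall k, billiard_map (z k) (z k.+1).

(* x is the code of z: the k-th letter is the side carrying the foot point of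
   S^k z.  A point has at most one code, and none if its forward orbit runs
   into a vertex. *)
Definition is_code (z : R * R) (x : nat -> side) : Prop :=
  exists o : nat -> R * R,
    [/\ o 0%N = z, forward_orbit o & forall k, on_side (x k) (o k).1].

Definition billiard_shift : set (nat -> side) :=
  [set x | exists z, is_code z x].

Definition liouville (A : set (R * R)) : \bar R :=
  (\int[lebesgue_measure \x lebesgue_measure]_(z in A `&` phase_space)
     (sin z.2)%:E)%E.

Definition billiard_shift_measure (B : set (nat -> side)) : \bar R :=
  (liouville [set z | exists2 x, is_code z x & B x] / liouville phase_space)%E.

End Billiard.

Arguments billiard_shift {R} Q _.
Arguments billiard_shift_measure {R} Q _.

Section MetricComplexity.
Context {R : realType} {A : finType}.
Variables (Sigma : set (nat -> A)) (nu : set (nat -> A) -> \bar R).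

Definition hamming k (a b : k.-tuple A) : R :=
  #|[pred i : 'I_k | tnth a i != tnth b i]|%:R / k%:R.

Definition prefix_word n (x : nat -> A) : n.-tuple A := [tuple x i | i < n].

Definition hamming_ball (x : nat -> A) (n : nat) (eps : R) : set (nat -> A) :=
  [set y | Sigma y /\ hamming (prefix_word n x) (prefix_word n y) < eps].

(* The Borel sets of Sigma, generated by the sets where one coordinate is
   prescribed. *)
Definition shift_measurable : set (set (nat -> A)) :=
  <<s Sigma, [set C | exists k a, C = Sigma `&` [set x | x k = a]] >>.

Definition ball_coverable (n : nat) (eps : R) (N : nat) : Prop :=
  exists B : set (nat -> A), exists c : 'I_N -> (nat -> A),
    [/\ shift_measurable B, ((1 - eps)%:E <= nu B)%E,
        (forall i, Sigma (c i)) &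
        B `<=` \bigcup_i hamming_ball (c i) n eps].

(* P(n, eps), as an infimum of naturals in the extended reals, hence a minimum
   as soon as some N is admissible. *)
Definition metric_complexity (n : nat) (eps : R) : \bar R :=
  ereal_inf [set (N%:R)%:E | N in ball_coverable n eps].

Definition upper_metric_complexity_le (g : nat -> nat) : Prop :=
  exists2 l : \bar R,
    limn_esup (fun n => metric_complexity n eps / ((g n)%:R)%:E)%E
      @[eps --> 0^'+] --> l & (l <= 1)%E.

End MetricComplexity.

(* Main.v *)
(* The argument uses the invariance of the Liouville measure m, not the growth of
   the number of words.  The points whose line of flight passes within d of a
   vertex have measure O(d), so, m being invariant, the points for which this
   happens at some time before n have measure O(n d).  With d of order eps / n
   this is at most eps m(P_Q).  Two remaining points at distance less than
   a constant times d / n on the same side have the same first n letters: along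
   the orbits their lines of flight diverge linearly in time, and the next side
   hit depends only on the sides of the line on which the vertices lie.  A grid
   of mesh of order eps / n ^ 2 thus gives P(n, eps) = O(n ^ 4), which is
   o(n ^ 6 f(n) ^ 2).

   That almost every point has an infinite orbit is a form of the Jordan curve
   theorem: along a line that avoids the vertices and is parallel to no side,
   the polygon is alternately entered and left.  The winding number on the left
   of a side does not change when one moves along the boundary; at the first
   crossing of a line it is 0 or 1, and the positive signed area excludes 0. *)
Require Import Defs.
From HB Require Import structures.
From mathcomp Require Import all_boot all_order all_algebra.
From mathcomp Require Import all_classical all_reals all_analysis.
From mathcomp Require Import measurable_realfun.
From mathcomp Require Import ring lra.
Import Order.TTheory GRing.Theory Num.Theory numFieldNormedType.Exports.
Local Open Scope classical_set_scope.
Local Open Scope ring_scope.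

Set Implicit Arguments.
Unset Strict Implicit.
Unset Printing Implicit Defensive.

(** * Crossings of a simple polygon with a line *)

(** The density sin theta carries both measure estimates. At a fixed angle the distance from a
    vertex to the line of flight is affine in the foot point, with slope of modulus sin theta; the
    density cancels this factor, so grazing directions cost nothing. Between two given sides the sum
    of the angles before and after the hit is constant, and at a fixed angle the map is affine in
    arc length with slope of modulus sin theta / sin theta'; this turns one density into the other.
    Only the inequality m(S^-1 E) <= m(E) is established, which suffices for a union bound over
    times. Without convexity, two lines that leave the same vertices on each side might a priori
    meet the sides in different orders. That they do not comes from a fact on pairs of sides: one of
    the two lies weakly on one side of the line carrying the other. Foot points are poor coordinates
    for comparing orbits, since each hit divides by the sine of the new angle. Whole lines of flight
    are compared instead, a reflection being an isometry on their directions. *)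

Section Gaps.
Context {R : realType}.

(** A telescoping sum cut at [a]: since [a] is itself one of the points, the midpoint of a gap lies
    below [a] exactly when the whole gap does. Midpoints avoid any tie at the points of the list. *)
Lemma sum_gaps_threshold (G : R -> R) (x a : R) (l : seq R) :
  path <%R x l -> a \in x :: l ->
  \sum_(g <- pairmap (fun y y' => (((y + y') / 2 < a)%R%:R) * (G y' - G y)) x l) g
  = G a - G x.
Proof.
elim: l x => [|y l IH] x /=.
  by move=> _; rewrite inE => /eqP ->; rewrite big_nil subrr.
move=> /andP[xy yl]; rewrite inE => /predU1P[->|al]; rewrite big_cons.
  have below z z' : x < z -> z < z' -> ((z + z') / 2 < x) = false.
    by move=> xz zz'; apply/negbTE; rewrite -leNgt; lra.
  rewrite subrr (_ : ((x + y) / 2 < x) = false); last first.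
    by apply/negbTE; rewrite -leNgt; lra.
  rewrite mul0r add0r.
  elim: l y xy yl {IH} => [|z l IH] y xy /=; first by rewrite big_nil.
  move=> /andP[yz zl]; rewrite big_cons below// mul0r add0r.
  by apply: IH => //; exact: lt_trans yz.
rewrite IH//; have ya : y <= a.
  move: al; rewrite inE => /predU1P[->//|al].
  by move: yl; rewrite (path_sortedE lt_trans) => /andP[/allP/(_ _ al)/ltW].
rewrite (_ : (x + y) / 2 < a = true) ?mul1r; first ring.
by apply/idP; lra.
Qed.

Lemma sum_gaps_ge0 (f : R -> R -> R) (s : seq R) (x : R) (l : seq R) :
  path <%R x l -> (forall z, z \in s -> z <= x \/ z \in l) ->
  (forall y y', y < y' -> (forall z, z \in s -> z <= y \/ y' <= z) -> 0 <= f y y') ->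
  0 <= \sum_(g <- pairmap f x l) g.
Proof.
move=> + + Hf; elim: l x => [|y l IH] x /=; first by rewrite big_nil.
move=> /andP[xy yl] Hs; rewrite big_cons addr_ge0//.
  apply: Hf => // z /Hs [zx|]; first by left.
  rewrite inE => /predU1P[->|zl]; first by right.
  by right; move: yl; rewrite (path_sortedE lt_trans) => /andP[/allP/(_ _ zl)/ltW].
apply: IH => // z /Hs [zx|]; first by left; exact/ltW/(le_lt_trans zx).
by rewrite inE => /predU1P[->|zl]; [left|right].
Qed.

Lemma sorted_support (s : seq R) (x0 : R) : x0 \in s ->
  exists x l, path <%R x l /\ (x :: l) =i s.
Proof.
move=> xs; have : sorted <%R (sort <=%R (undup s)).
  by rewrite lt_sorted_uniq_le sort_uniq undup_uniq/= sort_le_sorted.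
have : sort <=%R (undup s) =i s by move=> z; rewrite mem_sort mem_undup.
case: (sort _ _) => [/(_ x0)|x l Hs Hp]; first by rewrite xs.
by exists x, l.
Qed.

(* Abel summation: the hypothesis bounds the partial sums of the weights [s],
   taken in increasing order of the positions [U]. *)
Lemma sum_weighted_positions_ge0 (I : finType) (s U : I -> R) :
  \sum_i s i = 0 -> (forall w, \sum_i s i * (U i < w)%R%:R <= 0) ->
  0 <= \sum_i s i * U i.
Proof.
move=> s0 sle0; have [i0 _|I0] := pickP (mem I); last first.
  by rewrite big1// => i; have := I0 i; rewrite inE.
have [|x [l [xl xlE]]] := @sorted_support (codom U) (U i0).
  by apply/codomP; exists i0.
(* The weights sum to zero, so positions may be measured from the least one. *)
have -> : \sum_i s i * U i = \sum_i s i * (U i - x).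
  under [RHS]eq_bigr do rewrite mulrBr.
  by rewrite sumrB -mulr_suml s0 mul0r subr0.
have -> : \sum_i s i * (U i - x) = \sum_(g <- pairmap (fun y y' =>
    (\sum_i s i * ((y + y') / 2 < U i)%R%:R) * (y' - y)) x l) g.
  transitivity (\sum_i s i * \sum_(g <- pairmap (fun y y' =>
      (((y + y') / 2 < U i)%R%:R) * (y' - y)) x l) g).
    apply: eq_bigr => i _; rewrite (sum_gaps_threshold id)//.
    by rewrite xlE; apply/codomP; exists i.
  elim: l x {xl xlE} => [|y l IH] x /=.
    by rewrite big_nil big1// => i _; rewrite ?big_nil ?mulr0.
  rewrite big_cons -IH mulr_suml -big_split/=; apply: eq_bigr => i _.
  by rewrite big_cons; ring.
apply: (@sum_gaps_ge0 _ (codom U)) => //.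
  move=> z; rewrite -xlE inE => /predU1P[->|zl]; first by left.
  by right.
move=> y y' yy' Hz; rewrite mulr_ge0//; last by lra.
have -> : \sum_i s i * ((y + y') / 2 < U i)%R%:R =
    \sum_i s i - \sum_i s i * (U i < (y + y') / 2)%R%:R.
  rewrite -sumrB; apply: eq_bigr => i _.
  have : U i <= y \/ y' <= U i by apply: Hz; apply/codomP; exists i.
  case=> ?.
    have -> : (y + y') / 2 < U i = false by apply/negbTE; rewrite -leNgt; lra.
    have -> : U i < (y + y') / 2 = true by apply/idP; lra.
    by rewrite mulr0 mulr1 subrr.
  have -> : (y + y') / 2 < U i = true by apply/idP; lra.
  have -> : U i < (y + y') / 2 = false by apply/negbTE; rewrite -leNgt; lra.
  by rewrite mulr0 mulr1 subr0.
by rewrite s0 sub0r oppr_ge0.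
Qed.

End Gaps.

(** Connectedness by the intermediate value theorem: the indicator of [f c = f x] is locally
    constant, hence continuous, and it cannot take the value 1/2. *)
Lemma locally_constant_itv {R : realType} (f : R -> R) (a b : R) :
  (forall c, a < c < b -> \forall c' \near c, f c' = f c) ->
  forall x y, a < x < b -> a < y < b -> f x = f y.
Proof.
move=> Hf; suff H x y : a < x < b -> a < y < b -> x <= y -> f x = f y.
  move=> x y xab yab; have [xy|/ltW yx] := leP x y; first exact: H.
  by rewrite (H y x).
move=> /andP[ax xb] /andP[ay yb] xy; apply/eqP; apply/negPn/negP => fxy.
pose g c : R := (f c == f x)%:R.
have [c cxy gc] : exists2 c, c \in `[x, y] & g c = 2^-1.
  apply: IVT => //; last first.
    rewrite /g eqxx eq_sym (negbTE fxy)/= ge_min le_max.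
    by apply/andP; split; apply/orP; [right|left]; lra.
  have : {in `[x, y], continuous g}.
    move=> c; rewrite in_itv/= => /andP[xc cy].
    have /Hf fc : a < c < b by apply/andP; split; lra.
    by apply: cvg_near_cst; apply: filterS fc => c' fc'; rewrite /g fc'.
  by move=> H; apply: continuous_in_subspaceT => c /set_mem cxy; exact: H.
by move: gc; rewrite /g; case: (_ == _) => /=; lra.
Qed.

(** * Winding numbers along a moving line *)

Section Sweep.
Context {R : realType} (n : nat) (p u : 'I_n -> R).

(** Here [p] is the level of a vertex transversally to the sweeping line and [u] its position along
    that line. The chord is taken on the full line carrying the side, so that it is continuous in
    the level everywhere. *)
Definition chord (j : 'I_n) (c : R) : R :=
  u j + (c - p j) / (p (ordS j) - p j) * (u (ordS j) - u j).
(** The value is 1 for a rising side, -1 for a falling one and 0 for a side that is not met. The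
    lower end of a side counts and the upper one does not. As a difference of indicators at the two
    ends, it lends itself to summation by parts. *)
Definition crossing_sign (j : 'I_n) (c : R) : R :=
  (c < p (ordS j))%R%:R - (c < p j)%R%:R.
Definition spans (j : 'I_n) (c : R) : bool := (c - p j) * (c - p (ordS j)) <= 0.
(* Summed over all sides, this is the winding number of the polygon around the
   point of height w on the line of level c. *)
Definition crossings_before (J : pred 'I_n) (c w : R) : R :=
  \sum_(j | J j) crossing_sign j c * (chord j c < w)%R%:R.

Context (p_neq : forall j, p j != p (ordS j)).
Context (chord_neq : forall i j c, i != j -> spans i c -> spans j c ->
  chord i c = chord j c ->
  (j = ordS i /\ c = p j) \/ (i = ordS j /\ c = p i)).

Lemma chord_start j : chord j (p j) = u j.
Proof. by rewrite /chord subrr !mul0r addr0. Qed.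

Lemma chord_end j : chord j (p (ordS j)) = u (ordS j).
Proof.
by rewrite /chord divff ?subr_eq0 1?eq_sym// mul1r addrC subrK.
Qed.

Lemma chord_continuous j : continuous (chord j).
Proof.
move=> c; apply: cvgD; first exact: cvg_cst.
apply: cvgM; last exact: cvg_cst.
apply: cvgM; last exact: cvg_cst.
by apply: cvgB; [exact: cvg_id|exact: cvg_cst].
Qed.

Lemma near_lt_cst (a c : R) : a != c ->
  \forall c' \near c, (c' < a) = (c < a).
Proof.
rewrite neq_lt => /orP[ac|ca].
  near=> c'; rewrite [RHS]ltNge (ltW ac)/=; apply/negbTE; rewrite -leNgt ltW//.
  by near: c'; exact: lt_nbhsr.
near=> c'; rewrite ca; near: c'; exact: lt_nbhsl.
Unshelve. all: by end_near. Qed.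

Lemma crossing_sign0 j c : ~~ spans j c -> crossing_sign j c = 0.
Proof.
rewrite /spans -ltNge /crossing_sign => h.
have [a|a] := ltP c (p j); have [b|b] := ltP c (p (ordS j)); rewrite ?subrr//=.
- by move: h; rewrite nmulr_rgt0; lra.
- have : (c - p j) * (c - p (ordS j)) <= 0; last by lra.
  by rewrite mulr_ge0_le0//; lra.
Qed.

(* Summation by parts rewrites the sum over sides as a sum over vertices; only a
   vertex of level c could make it jump, and there the two adjacent chords
   coincide. *)
Lemma crossings_before_near (J : pred 'I_n) (w : R -> R) (c : R) :
  {for c, continuous w} ->
  (forall j, J j -> spans j c -> chord j c != w c) ->
  (forall k, p k = c -> J k = J (ord_pred k)) ->
  \forall c' \near c, crossings_before J c' (w c') = crossings_before J c (w c).
Proof.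
move=> wc Jw Jp.
(* The comparison with [w] is frozen at level [c]: nearby it can change only for sides that do not
   span [c], and their sign is 0 nearby. *)
pose b j : R := (chord j c < w c)%R%:R.
have nearb1 j : \forall c' \near c, J j ->
    crossing_sign j c' * (chord j c' < w c')%R%:R = crossing_sign j c' * b j.
  have [Jj|_] := boolP (J j); last by near=> c'.
  have [sj|sj] := boolP (spans j c).
    have gc : {for c, continuous (fun c' => w c' - chord j c')}.
      by apply: cvgB => //; exact: chord_continuous.
    have := Jw _ Jj sj; rewrite neq_lt => /orP[lt|lt].
      have : \forall c' \near c, 0 < w c' - chord j c'.
        by apply: (cvgr_gt _ gc); rewrite subr_gt0.
      by apply: filterS => c'; rewrite subr_gt0 /b lt => ->.
    have : \forall c' \near c, w c' - chord j c' < 0.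
      by apply: (cvgr_lt _ gc); rewrite subr_lt0.
    apply: filterS => c'; rewrite subr_lt0 /b => lt'.
    by rewrite !ltNge (ltW lt) (ltW lt').
  have : \forall c' \near c, 0 < (c' - p j) * (c' - p (ordS j)).
    have gc : {for c, continuous (fun c' => (c' - p j) * (c' - p (ordS j)))}.
      by apply: cvgM; apply: cvgB; [exact: cvg_id|exact: cvg_cst|
        exact: cvg_id|exact: cvg_cst].
    by apply: (cvgr_gt _ gc); move: sj; rewrite /spans -ltNge.
  apply: filterS => c' h _; rewrite !crossing_sign0 ?mul0r//.
  by rewrite /spans -ltNge.
have nearb := filter_forall _ nearb1.
have Hsum c' : (forall j, J j ->
    crossing_sign j c' * (chord j c' < w c')%R%:R = crossing_sign j c' * b j) ->
    crossings_before J c' (w c') = \sum_k (c' < p k)%R%:R *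
      ((J (ord_pred k))%:R * b (ord_pred k) - (J k)%:R * b k).
  move=> H; rewrite /crossings_before big_mkcond/=.
  transitivity (\sum_j ((c' < p (ordS j))%R%:R * ((J j)%:R * b j)
      - (c' < p j)%R%:R * ((J j)%:R * b j))).
    apply: eq_bigr => j _; case: ifPn => Jj; last by rewrite !mul0r !mulr0 subrr.
    by rewrite H// mul1r /crossing_sign mulrBl.
  under [RHS]eq_bigr do rewrite mulrBr.
  rewrite !sumrB; congr (_ - _); rewrite [RHS](reindex_inj (@ordS_inj n)).
  by apply: eq_bigr => j _; rewrite ordSK.
have nearp1 k : \forall c' \near c, p k != c -> (c' < p k) = (c < p k).
  have [pk|pk] := eqVneq (p k) c; first by near=> c'.
  by apply: filterS (near_lt_cst pk) => c'.
have nearp := filter_forall _ nearp1.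
near=> c'; rewrite !Hsum; last 2 first.
- by move=> j Jj.
- by near: c'; exact: nearb.
apply: eq_bigr => k _; have [pk|pk] := eqVneq (p k) c; last first.
  by congr ((_ : bool)%:R * _); move: k pk; near: c'; exact: nearp.
rewrite -(Jp _ pk); case: (J k); last by rewrite !mul0r subrr !mulr0.
have -> : b (ord_pred k) = b k; last by rewrite subrr !mulr0.
by rewrite /b -pk chord_start -[k in p k]ord_predK chord_end ord_predK.
Unshelve. all: by end_near. Qed.

Definition inside (j : 'I_n) (c : R) : bool := (c - p j) * (c - p (ordS j)) < 0.

Lemma insideW j c : inside j c -> spans j c.
Proof. exact: ltW. Qed.

Lemma inside_neq j c : inside j c -> (p j != c) /\ (p (ordS j) != c).
Proof.
by rewrite /inside => h; split; apply/eqP => e; move: h;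
  rewrite -e subrr ?mul0r ?mulr0 ltxx.
Qed.

Lemma insideE j c : p j != c -> p (ordS j) != c ->
  inside j c = (crossing_sign j c != 0).
Proof.
rewrite /inside /crossing_sign => /lt_total/orP[]a /lt_total/orP[]b.
- rewrite [c < p j]ltNge (ltW a) [c < p (ordS j)]ltNge (ltW b)/= subrr eqxx.
  by apply/negbTE; rewrite -leNgt mulr_ge0// subr_ge0 ltW.
- rewrite [c < p j]ltNge (ltW a) b/= subr0 oner_eq0.
  by rewrite pmulr_rlt0 ?subr_gt0// subr_lt0.
- rewrite [c < p (ordS j)]ltNge (ltW b) a/= sub0r oppr_eq0 oner_eq0.
  by rewrite nmulr_rlt0 ?subr_lt0// subr_gt0.
- rewrite a b/= subrr eqxx.
  by apply/negbTE; rewrite -leNgt mulr_le0// subr_le0 ltW.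
Qed.

Lemma inside_between j c : inside j c ->
  Num.min (p j) (p (ordS j)) < c < Num.max (p j) (p (ordS j)).
Proof.
rewrite /inside gt_min lt_max => h; apply/andP; split.
  rewrite -(subr_gt0 (p j)) -(subr_gt0 (p _)).
  have [//|a] := ltP 0 (c - p j); have [//|b] := ltP 0 (c - p (ordS j)).
  by move: h; rewrite ltNge mulr_le0.
rewrite -(subr_lt0 (p j)) -(subr_lt0 (p _)).
have [//|a] := ltP (c - p j) 0; have [//|b] := ltP (c - p (ordS j)) 0.
by move: h; rewrite ltNge mulr_ge0.
Qed.

Lemma between_inside j c :
  Num.min (p j) (p (ordS j)) < c < Num.max (p j) (p (ordS j)) -> inside j c.
Proof.
rewrite /inside gt_min lt_max => /andP[/orP[a|a] /orP[b|b]];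
  (try by lra); first by rewrite pmulr_rlt0; lra.
by rewrite nmulr_rlt0; lra.
Qed.

(* The winding number just to the left of side i. *)
Definition left_value (i : 'I_n) (c : R) : R :=
  crossings_before (predC1 i) c (chord i c) + (p i < p (ordS i))%R%:R.

(** While the level stays strictly inside side [i], no other chord can meet that of [i], so no
    comparison changes. A vertex passed at such a level is not an end of [i], and the two sides
    adjacent to it balance. *)
Lemma left_value_side i c c' : inside i c -> inside i c' ->
  left_value i c = left_value i c'.
Proof.
move=> ic ic'; congr (_ + _).
apply: (@locally_constant_itv _ (fun c => crossings_before (predC1 i) c (chord i c))
  _ _ _ c c' (inside_between ic) (inside_between ic')) => {ic c' ic'}c ic.
have {ic} ic := between_inside ic; have [ci ci'] := inside_neq ic.
apply: crossings_before_near; first exact: chord_continuous.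
  move=> j ji sj; apply/eqP => /esym e.
  have [|[ej ec]|[ej ec]] := chord_neq _ (insideW ic) sj e; first by rewrite eq_sym.
    by rewrite ec ej eqxx in ci'.
  by rewrite ec eqxx in ci.
move=> k pk /=; have -> : k != i by apply: contraNneq ci => <-; rewrite pk.
apply/esym; apply: contraNneq ci' => <-.
by rewrite ord_predK pk.
Qed.

(** Near the vertex of level [B] the other sides contribute a constant. If the level passes
    monotonically through [B], the test levels are taken on either side of it and neither side sees
    the other. At a local extremum of the level a single test level meets both sides, and whichever
    chord comes first, the two values agree. *)
Lemma left_value_vertex i : exists c c',
  [/\ inside i c, inside (ordS i) c' & left_value i c = left_value (ordS i) c'].
Proof.
set k := ordS i; set A := p i; set B := p k; set C := p (ordS k).
have AB : A != B := p_neq i; have BC : B != C := p_neq k.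
have ik : i != k by apply: contraNneq AB; rewrite /A /B => <-.
pose J : pred 'I_n := fun j => (j != i) && (j != k).
have iB : chord i B = u k by exact: chord_end.
have kB : chord k B = u k by exact: chord_start.
have siB : spans i B by rewrite /spans subrr mulr0.
have Jw j : J j -> spans j B -> chord j B != u k.
  move=> /andP[ji jk] sj; apply/eqP => e.
  have [|[ej _]|[_ ej]] := chord_neq _ siB sj (etrans iB (esym e)).
  - by rewrite eq_sym.
  - by rewrite ej eqxx in jk.
  - by rewrite /A -ej eqxx in AB.
have Jp l : p l = B -> J l = J (ord_pred l).
  rewrite /J => pl; have -> : l != i by apply: contraNneq AB => e; rewrite /A -e pl.
  have -> : ord_pred l != k.
    by apply: contraNneq BC => e; rewrite /C -e ord_predK pl.
  rewrite andbT/=; congr (~~ _); apply/eqP/eqP => [->|e]; first exact: ordSK.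
  by rewrite /k -e ord_predK.
have nearM w : {for B, continuous w} -> w B = u k ->
    \forall c \near B, crossings_before J c (w c) = crossings_before J B (u k).
  by move=> cw wB; rewrite -wB; apply: crossings_before_near => // j; rewrite wB; exact: Jw.
have /nbhs_ballP[e /= e0 eM] : \forall c \near B,
    crossings_before J c (chord i c) = crossings_before J B (u k) /\
    crossings_before J c (chord k c) = crossings_before J B (u k).
  apply: filterS2 (nearM _ (@chord_continuous i B) iB)
    (nearM _ (@chord_continuous k B) kB) => c; by split.
(* This [d] keeps the test levels [B - d] and [B + d] in the ball where the other sides contribute a
   constant, and short of the far ends of both sides. *)
have [d [d0 de dA dC]] : exists d, [/\ 0 < d, d < e, d < `|A - B| & d < `|C - B|].
  have nA : 0 < `|A - B| by rewrite normr_gt0 subr_eq0.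
  have nC : 0 < `|C - B| by rewrite normr_gt0 subr_eq0 eq_sym.
  exists (Num.min e (Num.min `|A - B| `|C - B|) / 2).
  have m0 : 0 < Num.min e (Num.min `|A - B| `|C - B|) by rewrite !lt_min e0 nA nC.
  have := lexx (Num.min e (Num.min `|A - B| `|C - B|)).
  by rewrite {2}/Num.min !le_min => /and3P[h1 h2 h3]; split; lra.
have HBd s : `|s| = d -> ball B e (B + s).
  by move=> ns; rewrite /ball/= opprD addNKr normrN ns.
have lvi c : ball B e c -> left_value i c = crossings_before J B (u k) +
    crossing_sign k c * (chord k c < chord i c)%R%:R + (A < B)%R%:R.
  move=> /eM[<- _]; rewrite /left_value /crossings_before (bigD1 k)/=; last by rewrite eq_sym.
  by congr (_ + _); rewrite addrC.
have lvk c : ball B e c -> left_value k c = crossings_before J B (u k) +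
    crossing_sign i c * (chord i c < chord k c)%R%:R + (B < C)%R%:R.
  move=> /eM[_ <-]; rewrite /left_value /crossings_before (bigD1 i)//=.
  congr (_ + _); rewrite addrC; congr (_ + _); apply: eq_bigl => j.
  by rewrite /J andbC.
have csk c : crossing_sign k c = (c < C)%R%:R - (c < B)%R%:R by [].
have csi c : crossing_sign i c = (c < B)%R%:R - (c < A)%R%:R by [].
have insi c : inside i c = ((c - A) * (c - B) < 0) by [].
have insk c : inside k c = ((c - B) * (c - C) < 0) by [].
have neq_ik c : inside i c -> inside k c -> chord i c != chord k c.
  move=> hi hk; apply/eqP => h.
  have [] := chord_neq ik (insideW hi) (insideW hk) h => -[_ hc].
    by have [_] := inside_neq hi; rewrite -/k hc eqxx.
  by have [] := inside_neq hi; rewrite hc eqxx.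
have ltT (x y : R) : x < y -> (x < y) = true by [].
have ltF (x y : R) : y <= x -> (x < y) = false by rewrite ltNge => ->.
case/lt_total/orP: AB => AB; case/lt_total/orP: BC => BC.
- rewrite ltr0_norm in dA; last by lra.
  rewrite gtr0_norm in dC; last by lra.
  exists (B - d), (B + d); rewrite insi insk; split.
  + by rewrite pmulr_rlt0; lra.
  + by rewrite pmulr_rlt0; lra.
  rewrite lvi ?lvk; last 2 first.
  + by apply: HBd; rewrite gtr0_norm.
  + by apply: HBd; rewrite normrN gtr0_norm.
  have h1 : B - d < C by lra.
  have h2 : B - d < B by lra.
  have h3 : B <= B + d by lra.
  have h4 : A <= B + d by lra.
  rewrite csk csi (ltT _ _ h1) (ltT _ _ h2) (ltF _ _ h3) (ltF _ _ h4).
  by rewrite !subrr !mul0r AB BC.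
- rewrite ltr0_norm in dA; last by lra.
  rewrite ltr0_norm in dC; last by lra.
  exists (B - d), (B - d).
  have hi : inside i (B - d) by rewrite insi pmulr_rlt0; lra.
  have hk : inside k (B - d) by rewrite insk nmulr_rlt0; lra.
  split=> //; rewrite lvi ?lvk; last 2 first.
  + by apply: HBd; rewrite normrN gtr0_norm.
  + by apply: HBd; rewrite normrN gtr0_norm.
  have h1 : C <= B - d by lra.
  have h2 : B - d < B by lra.
  have h3 : A <= B - d by lra.
  rewrite csk csi (ltF _ _ h1) (ltT _ _ h2) (ltF _ _ h3) AB (ltF _ _ (ltW BC)).
  by have := neq_ik _ hi hk; rewrite neq_lt => /orP[]h;
    rewrite h (ltF _ _ (ltW h))/=; ring.
- rewrite gtr0_norm in dA; last by lra.
  rewrite gtr0_norm in dC; last by lra.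
  exists (B + d), (B + d).
  have hi : inside i (B + d) by rewrite insi nmulr_rlt0; lra.
  have hk : inside k (B + d) by rewrite insk pmulr_rlt0; lra.
  split=> //; rewrite lvi ?lvk; last 2 first.
  + by apply: HBd; rewrite gtr0_norm.
  + by apply: HBd; rewrite gtr0_norm.
  have h1 : B + d < C by lra.
  have h2 : B <= B + d by lra.
  have h3 : B + d < A by lra.
  rewrite csk csi (ltT _ _ h1) (ltF _ _ h2) (ltT _ _ h3) BC (ltF _ _ (ltW AB)).
  by have := neq_ik _ hi hk; rewrite neq_lt => /orP[]h;
    rewrite h (ltF _ _ (ltW h))/=; ring.
- rewrite gtr0_norm in dA; last by lra.
  rewrite ltr0_norm in dC; last by lra.
  exists (B + d), (B - d); rewrite insi insk; split.
  + by rewrite nmulr_rlt0; lra.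
  + by rewrite nmulr_rlt0; lra.
  rewrite lvi ?lvk; last 2 first.
  + by apply: HBd; rewrite normrN gtr0_norm.
  + by apply: HBd; rewrite gtr0_norm.
  have h1 : C <= B + d by lra.
  have h2 : B <= B + d by lra.
  have h3 : B - d < B by lra.
  have h4 : B - d < A by lra.
  rewrite csk csi (ltF _ _ h1) (ltF _ _ h2) (ltT _ _ h3) (ltT _ _ h4).
  by rewrite !subrr !mul0r (ltF _ _ (ltW AB)) (ltF _ _ (ltW BC)).
Qed.

End Sweep.

Lemma itv_avoid {R : realType} (a b : R) (s : seq R) : a < b ->
  exists2 c, a < c < b & c \notin s.
Proof.
move=> ab; suff [a' [b' [aa' ab' bb' H]]] : exists a' b',
    [/\ a <= a', a' < b', b' <= b & forall x, x \in s -> x <= a' \/ b' <= x].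
  exists ((a' + b') / 2); first by apply/andP; split; lra.
  by apply/negP => /H[]; lra.
elim: s => [|x s [a' [b' [aa' ab' bb' H]]]]; first by exists a, b.
have [xa|ax] := leP x a'.
  exists a', b'; split=> // z; rewrite inE => /predU1P[->|/H//]; by left.
exists a', (Num.min x b'); split=> //; first by rewrite lt_min ax.
  by rewrite ge_min bb' orbT.
move=> z; rewrite inE => /predU1P[->|/H[|h]]; first by right; rewrite ge_min lexx.
  by left.
by right; rewrite ge_min h orbT.
Qed.

Lemma ordS_invariant_cst {T : Type} n (g : 'I_n -> T) :
  (forall i, g (ordS i) = g i) -> forall i j, g i = g j.
Proof.
move=> gS; suff H k (hk : (k < n)%N) (h0 : (0 < n)%N) :
    g (Ordinal hk) = g (Ordinal h0).
  move=> [i hi] [j hj]; have h0 : (0 < n)%N by exact: leq_ltn_trans hi.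
  by rewrite (H i hi h0) (H j hj h0).
elim: k hk => [|k IH] hk; first by congr g; exact: val_inj.
have hk' : (k < n)%N by exact: ltnW.
rewrite -(IH hk') -(gS (Ordinal hk')); congr g; apply: val_inj => /=.
by rewrite modn_small.
Qed.

(** * Entries and exits alternate along a line *)

Section Alternation.
Context {R : realType} (n : nat) (p u : 'I_n -> R).
Context (p_neq : forall j, p j != p (ordS j)).
Context (chord_neq : forall i j c, i != j -> spans p i c -> spans p j c ->
  chord p u i c = chord p u j c ->
  (j = ordS i /\ c = p j) \/ (i = ordS j /\ c = p i)).
Local Notation U := (chord p u).
Local Notation sgn := (crossing_sign p).
Local Notation ins := (inside p).

Let before (c w : R) : R := \sum_j sgn j c * (U j c < w)%R%:R.

(** Constancy along each side and across each vertex is chained around the polygon, with the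
    mid-level of each side as its representative. *)
Lemma left_value_cst : exists h, forall i c, ins i c -> left_value p u i c = h.
Proof.
pose m i := (p i + p (ordS i)) / 2.
have mi i : ins i (m i).
  apply: between_inside; rewrite /m gt_min lt_max.
  by case/lt_total/orP: (p_neq i) => h; apply/andP; split; apply/orP;
    [left|right|right|left]; lra.
have gS i : left_value p u (ordS i) (m (ordS i)) = left_value p u i (m i).
  have [c [c' [ic ic' e]]] := left_value_vertex p_neq chord_neq i.
  rewrite (left_value_side p_neq chord_neq (mi i) ic) e.
  exact: left_value_side.
have [i0 _|I0] := pickP (mem 'I_n); last first.
  by exists 0 => i; have := I0 i; rewrite inE.
exists (left_value p u i0 (m i0)) => i c ic.
rewrite (left_value_side p_neq chord_neq ic (mi i)).
exact: (@ordS_invariant_cst _ _ (fun i => left_value p u i (m i))).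
Qed.

(** A closed polygon has no boundary terms: cyclic sums of differences vanish, which gives both the
    balance of crossing signs and the shoelace identity. *)
Lemma sum_ordS (g : 'I_n -> R) : \sum_j g (ordS j) = \sum_j g j.
Proof. by rewrite [RHS](reindex_inj (@ordS_inj n)). Qed.

Lemma sum_crossing_sign c : \sum_j sgn j c = 0.
Proof. by rewrite sumrB (sum_ordS (fun j => (c < p j)%R%:R)) subrr. Qed.

Section Level.
Context (c : R) (cp : forall k, p k != c).

Lemma outside_crossing_sign j : ~~ ins j c -> sgn j c = 0.
Proof. by rewrite insideE// negbK => /eqP. Qed.

Lemma crossing_sign_inside j : ins j c -> sgn j c = 2 * (p j < p (ordS j))%R%:R - 1.
Proof.
move=> /inside_between; rewrite /crossing_sign gt_min lt_max.
case/lt_total/orP: (p_neq j) => h /andP[a b].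
  rewrite h; have -> : c < p j = false.
    by apply/negbTE; rewrite -leNgt; case/orP: a; lra.
  have -> : c < p (ordS j) by case/orP: b => // ?; lra.
  rewrite /=; ring.
have -> : p j < p (ordS j) = false by rewrite ltNge ltW.
have -> : c < p (ordS j) = false.
  by apply/negbTE; rewrite -leNgt; case/orP: a; lra.
have -> : c < p j by case/orP: b => // ?; lra.
rewrite /=; ring.
Qed.

Lemma chord_inj i j : ins i c -> ins j c -> U i c = U j c -> i = j.
Proof.
move=> ic jc e; apply/eqP/negPn/negP => ij.
have [[_ h]|[_ h]] := chord_neq ij (insideW ic) (insideW jc) e.
  by move: (cp j); rewrite h eqxx.
by move: (cp i); rewrite h eqxx.
Qed.

Context (h : R) (hP : forall i c, ins i c -> left_value p u i c = h).

Lemma before_inside i : ins i c -> before c (U i c) = h - (p i < p (ordS i))%R%:R.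
Proof.
move=> ic; rewrite -(hP ic) /left_value addrK /crossings_before /before.
by rewrite (bigD1 i)//= ltxx mulr0 add0r.
Qed.

Lemma before_after i w : ins i c -> U i c < w ->
  (forall k, ins k c -> U k c < w -> U k c <= U i c) ->
  before c w = before c (U i c) + sgn i c.
Proof.
move=> ic iw H; rewrite /before (bigD1 i)//= [in RHS](bigD1 i)//= ltxx iw.
rewrite mulr1 mulr0 add0r addrC; congr (_ + _); apply: eq_bigr => k ki.
have [kc|/outside_crossing_sign ->] := boolP (ins k c); last by rewrite !mul0r.
congr (_ * (_ : bool)%:R); apply/idP/idP => [kw|]; last by move=> /lt_trans; apply.
rewrite lt_neqAle H// andbT; apply: contraNneq ki => e.
by apply/eqP; exact: chord_inj.
Qed.

Lemma left_value01 i : ins i c -> h = 0 \/ h = 1.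
Proof.
move=> ic; have [j jc jmin] := @arg_minP _ _ _ i (fun j => ins j c) (fun j => U j c) ic.
have := before_inside jc; rewrite /before big1; last first.
  move=> k _; have [kc|/outside_crossing_sign ->] := boolP (ins k c); last by rewrite mul0r.
  by rewrite ltNge jmin ?mulr0.
by case: (_ < _) => /=; [right|left]; lra.
Qed.

(** If the left value is 0, a rising side leads from -1 to 0 and a falling one from 0 to -1. The
    value at [w] is the one reached after the last crossing before [w]. *)
Lemma before_le0 w : h = 0 -> before c w <= 0.
Proof.
move=> h0; have [i /andP[ic iw]|H] := pickP [pred j | ins j c & U j c < w]; last first.
  rewrite /before big1// => k _; have [kc|/outside_crossing_sign ->] := boolP (ins k c).
    by have := H k; rewrite /= kc /= => ->; rewrite mulr0.
  by rewrite mul0r.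
have Pi : [pred j | ins j c & U j c < w] i by rewrite /= ic.
have [j /andP[jc jw] jmax] := @arg_maxP _ _ _ i [pred j | ins j c & U j c < w] (fun j => U j c) Pi.
rewrite (before_after jc jw).
  by rewrite before_inside// crossing_sign_inside// h0; case: (_ < _) => /=; lra.
by move=> k kc kw; apply: jmax; rewrite /= kc.
Qed.

(** If the left value is 1, a rising side leads from 0 to 1 and a falling one from 1 to 0. After the
    rising side [i] the value is 1, so the next side met is falling. There is a next one: otherwise
    the sum of all signs, which is 0, would be 1. *)
Lemma next_exit i : h = 1 -> p i < c < p (ordS i) ->
  exists j, [/\ p (ordS j) < c < p j, U i c < U j c &
    forall k, ins k c -> U i c < U k c -> U j c <= U k c].
Proof.
move=> h1 /andP[ic1 ic2].
have ic : ins i c by rewrite /inside pmulr_rlt0 ?subr_gt0// subr_lt0.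
have pi_lt : p i < p (ordS i) by exact: lt_trans ic2.
have bi : before c (U i c) = 0 by rewrite before_inside// pi_lt h1 subrr.
have si : sgn i c = 1 by rewrite crossing_sign_inside// pi_lt/=; ring.
have [k0 Pk0|H] := pickP [pred k | ins k c & U i c < U k c]; last first.
  have [w iw wle] : exists2 w, U i c < w & forall k, U k c < w.
    exists (1 + \big[Num.max/U i c]_k U k c).
      by rewrite ltr_pwDl// bigmax_idl le_max lexx.
    by move=> k; rewrite ltr_pwDl// le_bigmax_cond.
  have := sum_crossing_sign c.
  have -> : \sum_j sgn j c = before c w.
    by apply: eq_bigr => j _; rewrite wle mulr1.
  rewrite (before_after ic iw); first by rewrite bi si; lra.
  by move=> k kc _; have := H k; rewrite /= kc/= ltNge => /negbFE.
have [j /andP[jc jw] jmin] :=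
  @arg_minP _ _ _ k0 [pred k | ins k c & U i c < U k c] (fun j => U j c) Pk0.
exists j; split=> //; last by move=> k kc kw; apply: jmin; rewrite /= kc.
have := before_inside jc; rewrite (@before_after i)//; last first.
  move=> k kc kj; rewrite leNgt; apply/negP => ik.
  have := jmin k; rewrite /= kc ik => /(_ isT).
  by rewrite leNgt kj.
rewrite bi si h1; case: ltP => [_ /=|pj _]; first by lra.
have := inside_between jc; rewrite gt_min lt_max => /andP[a b].
by apply/andP; split; [case/orP: a|case/orP: b] => //; lra.
Qed.

End Level.

(** With left value 0 the winding number would be nowhere positive, and neither would the area,
    which is its integral. The integral is computed slab by slab between consecutive levels of
    vertices, where signs are constant and chords affine. As the signs sum to zero, the signed sum
    of chord positions is minus the integral of the winding number along the line. *)
Lemma left_value1 h (i : 'I_n) : (forall i c, ins i c -> left_value p u i c = h) ->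
  0 < \sum_j (p j * u (ordS j) - u j * p (ordS j)) -> h = 1.
Proof.
move=> hP area.
have [c [cp ic]] : exists c, (forall k, p k != c) /\ ins i c.
  have : Num.min (p i) (p (ordS i)) < Num.max (p i) (p (ordS i)).
    by case/lt_total/orP: (p_neq i) => h1; rewrite gt_min !lt_max h1 ?orbT.
  move=> /(itv_avoid (codom p))[c ci cn].
  exists c; split; last exact: between_inside.
  by move=> k; apply: contraNneq cn => <-; apply/codomP; exists k.
have [h0|//] := left_value01 cp hP ic.
(* This trapezoid sum is minus half of the shoelace sum, so that its nonnegativity contradicts
   [area]. *)
suff : 0 <= \sum_j ((p (ordS j) - p j) * (u j + u (ordS j)) / 2).
  have -> : \sum_j ((p (ordS j) - p j) * (u j + u (ordS j)) / 2) =
    - (\sum_j (p j * u (ordS j) - u j * p (ordS j))) / 2.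
    have e := sum_ordS (fun j => p j * u j).
    transitivity (\sum_j (- (p j * u (ordS j) - u j * p (ordS j)) / 2 +
      (p (ordS j) * u (ordS j) - p j * u j) / 2)).
      by apply: eq_bigr => j _; ring.
    by rewrite big_split/= -!mulr_suml sumrB e subrr mul0r addr0 sumrN.
  by lra.
pose D j := p (ordS j) - p j.
have D0 j : D j != 0 by rewrite /D subr_eq0 eq_sym.
(* An antiderivative of [chord j] in the level. The chord being affine, the increment of [G j] over
   a slab is the height of the slab times the chord at mid-level. *)
pose G j (y : R) := u j * y + (y - p j) ^+ 2 / 2 / D j * (u (ordS j) - u j).
have -> : \sum_j ((p (ordS j) - p j) * (u j + u (ordS j)) / 2) =
    \sum_j (G j (p (ordS j)) - G j (p j)).
  apply: eq_bigr => j _; rewrite /G -/(D j); have -> : p (ordS j) = p j + D j.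
    by rewrite /D addrC subrK.
  by field; exact: D0.
have [|x [l [xl xlE]]] := @sorted_support _ (codom p) (p i).
  by apply/codomP; exists i.
have pxl j : p j \in x :: l by rewrite xlE; apply/codomP; exists j.
have -> : \sum_j (G j (p (ordS j)) - G j (p j)) =
    \sum_(g <- pairmap (fun y y' => \sum_j sgn j ((y + y') / 2) * (G j y' - G j y)) x l) g.
  transitivity (\sum_j \sum_(g <- pairmap (fun y y' =>
      sgn j ((y + y') / 2) * (G j y' - G j y)) x l) g).
    apply: eq_bigr => j _.
    have -> : G j (p (ordS j)) - G j (p j) = (G j (p (ordS j)) - G j x) - (G j (p j) - G j x).
      by ring.
    rewrite -(sum_gaps_threshold (G j) xl (pxl (ordS j))).
    rewrite -(sum_gaps_threshold (G j) xl (pxl j)).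
    elim: l x {xl xlE pxl} => [|y l IH] x /=; first by rewrite !big_nil subrr.
    rewrite !big_cons -IH /crossing_sign; ring.
  elim: l x {xl xlE pxl} => [|y l IH] x /=.
    by rewrite big_nil big1// => j _; rewrite ?big_nil.
  rewrite big_cons -IH -big_split/=; apply: eq_bigr => j _.
  by rewrite big_cons.
apply: (@sum_gaps_ge0 _ _ (codom p)) => //.
  move=> z; rewrite -xlE inE => /predU1P[->|zl]; first by left.
  by right.
(* The mid-level of a slab is not the level of a vertex, so the analysis at a generic level applies
   there. *)
move=> y y' yy' Hz; set m := (y + y') / 2.
have mp k : p k != m.
  have [||] := Hz (p k); first by apply/codomP; exists k.
    by rewrite /m neq_lt => ?; apply/orP; left; lra.
  by rewrite /m neq_lt => ?; apply/orP; right; lra.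
have -> : \sum_j sgn j m * (G j y' - G j y) = (y' - y) * \sum_j sgn j m * U j m.
  rewrite mulr_sumr; apply: eq_bigr => j _.
  rewrite /G /chord -/(D j) /m; field; exact: D0.
apply: mulr_ge0; first by lra.
apply: sum_weighted_positions_ge0; first exact: sum_crossing_sign.
by move=> w; exact: (before_le0 mp hP).
Qed.

End Alternation.

(** * The first side hit by a trajectory *)

Section Plane.
Context {R : realType}.
Local Notation plane := (R^o * R^o)%type.
Implicit Types (x y d : plane) (t : R).

Lemma crossDl x y d : cross (x + y) d = cross x d + cross y d.
Proof. by rewrite /cross /=; ring. Qed.
Lemma crossBl x y d : cross (x - y) d = cross x d - cross y d.
Proof. by rewrite /cross /=; ring. Qed.
Lemma crossZl t y d : cross (t *: y) d = t * cross y d.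
Proof. by rewrite /cross /= /GRing.scale /=; ring. Qed.
Lemma crossDr d x y : cross d (x + y) = cross d x + cross d y.
Proof. by rewrite /cross /=; ring. Qed.
Lemma crossBr d x y : cross d (x - y) = cross d x - cross d y.
Proof. by rewrite /cross /=; ring. Qed.
Lemma crossZr t d y : cross d (t *: y) = t * cross d y.
Proof. by rewrite /cross /= /GRing.scale /=; ring. Qed.
Lemma crossvv x : cross x x = 0.
Proof. by rewrite /cross; ring. Qed.
Lemma dotDl x y d : dot (x + y) d = dot x d + dot y d.
Proof. by rewrite /dot /=; ring. Qed.
Lemma dotBl x y d : dot (x - y) d = dot x d - dot y d.
Proof. by rewrite /dot /=; ring. Qed.
Lemma dotZl t y d : dot (t *: y) d = t * dot y d.
Proof. by rewrite /dot /= /GRing.scale /=; ring. Qed.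
Lemma dotDr d x y : dot d (x + y) = dot d x + dot d y.
Proof. by rewrite /dot /=; ring. Qed.
Lemma dotBr d x y : dot d (x - y) = dot d x - dot d y.
Proof. by rewrite /dot /=; ring. Qed.
Lemma dotZr t d y : dot d (t *: y) = t * dot d y.
Proof. by rewrite /dot /= /GRing.scale /=; ring. Qed.
Lemma dotC x y : dot x y = dot y x.
Proof. by rewrite /dot; ring. Qed.
Lemma crossC x y : cross x y = - cross y x.
Proof. by rewrite /cross; ring. Qed.
Lemma dot_rot90 x : dot x (rot90 x) = 0.
Proof. by rewrite /dot /rot90 /=; ring. Qed.
Lemma dot_rot90_rot90 x : dot (rot90 x) (rot90 x) = dot x x.
Proof. by rewrite /dot /rot90 /=; ring. Qed.
Lemma cross_rot90 x : cross x (rot90 x) = dot x x.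
Proof. by rewrite /cross /dot /rot90 /=; ring. Qed.
Lemma dot_rot90r x d : dot d (rot90 x) = cross x d.
Proof. by rewrite /cross /dot /rot90 /=; ring. Qed.
Lemma cross_rot90r x d : cross d (rot90 x) = dot d x.
Proof. by rewrite /cross /dot /rot90 /=; ring. Qed.

Lemma plane_eq d x y : dot d d = 1 -> dot x d = dot y d -> cross x d = cross y d ->
  x = y.
Proof.
case: d x y => [d1 d2] [x1 x2] [y1 y2]; rewrite /dot /cross /= => dd e1 e2.
congr pair.
  have -> : x1 = x1 * (d1 * d1 + d2 * d2) by rewrite dd mulr1.
  have -> : y1 = y1 * (d1 * d1 + d2 * d2) by rewrite dd mulr1.
  transitivity (d1 * (x1 * d1 + x2 * d2) + d2 * (x1 * d2 - x2 * d1)); first ring.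
  by rewrite e1 e2; ring.
have -> : x2 = x2 * (d1 * d1 + d2 * d2) by rewrite dd mulr1.
have -> : y2 = y2 * (d1 * d1 + d2 * d2) by rewrite dd mulr1.
transitivity (d2 * (x1 * d1 + x2 * d2) - d1 * (x1 * d2 - x2 * d1)); first ring.
by rewrite e1 e2; ring.
Qed.

(** Level and position relative to a unit vector [d] are obtained by a rotation of the plane, which
    preserves signed areas. The shoelace sum can thus be read in these coordinates. *)
Lemma cross_dot_cross x y d : dot d d = 1 ->
  cross x d * dot y d - dot x d * cross y d = cross x y.
Proof.
by move=> dd; rewrite -[RHS]mulr1 -dd /dot /cross; ring.
Qed.

End Plane.

Section Polygon.
Context {R : realType} (Q : polygon R).
Local Notation plane := (R^o * R^o)%type.
Local Notation side := 'I_(nsides Q).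
Implicit Types (i j k : side) (z : R * R).

Lemma vertexS i : vertex Q (ordS i) = vertex Q i + side_vector i.
Proof. by rewrite /side_vector /edge addrC subrK. Qed.

Lemma side_vector_neq0 i : dot (side_vector i) (side_vector i) != 0.
Proof.
have := polygon_corner i; rewrite -/(side_vector i) -/(side_vector (ordS i)).
apply: contraNneq; case: (side_vector i) => a b; rewrite /dot /cross /=.
move/eqP; rewrite paddr_eq0 -?expr2 ?sqr_ge0// !sqrf_eq0 => /andP[/eqP -> /eqP ->].
by rewrite !mul0r subrr.
Qed.

Lemma side_length_gt0 i : 0 < side_length i.
Proof.
rewrite sqrtr_gt0 lt0r side_vector_neq0/=.
by rewrite /dot addr_ge0// -expr2 sqr_ge0.
Qed.

Lemma side_lengthZ i : side_length i *: tangent i = side_vector i.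
Proof. by rewrite /tangent scalerA mulfV ?scale1r// gt_eqF// side_length_gt0. Qed.

Lemma dot_tangent i : dot (tangent i) (tangent i) = 1.
Proof.
have l0 : side_length i != 0 by rewrite gt_eqF// side_length_gt0.
have e : dot (side_vector i) (side_vector i) = side_length i * side_length i.
  by rewrite -expr2 sqr_sqrtr// /dot addr_ge0// -expr2 sqr_ge0.
by rewrite /tangent dotZl dotZr e mulKf// mulVf.
Qed.

Lemma dot_normal i : dot (inner_normal i) (inner_normal i) = 1.
Proof. by rewrite dot_rot90_rot90 dot_tangent. Qed.

Lemma dot_tangent_normal i : dot (tangent i) (inner_normal i) = 0.
Proof. exact: dot_rot90. Qed.

Lemma cross_tangent_normal i : cross (tangent i) (inner_normal i) = 1.
Proof. by rewrite cross_rot90 dot_tangent. Qed.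

Lemma dot_direction i t : dot (direction i t) (direction i t) = 1.
Proof.
rewrite /direction /inner_normal; move: (tangent i) (dot_tangent i) => e ee.
rewrite !(dotDl, dotDr, dotZl, dotZr) dot_rot90_rot90 [dot (rot90 e) e]dotC dot_rot90 ee.
by rewrite !mulr0 addr0 add0r !mulr1 -!expr2 cos2Dsin2.
Qed.

Lemma cross_tangent_direction i t : cross (tangent i) (direction i t) = sin t.
Proof.
rewrite /direction /inner_normal; move: (tangent i) (dot_tangent i) => e ee.
by rewrite crossDr !crossZr crossvv cross_rot90 ee mulr0 mulr1 add0r.
Qed.

Lemma dot_tangent_direction i t : dot (tangent i) (direction i t) = cos t.
Proof.
rewrite /direction /inner_normal; move: (tangent i) (dot_tangent i) => e ee.
by rewrite dotDr !dotZr dot_rot90 ee mulr0 mulr1 addr0.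
Qed.

Lemma foot_vector i s : foot i s =
  vertex Q i + ((s - side_start i) / side_length i) *: side_vector i.
Proof.
by rewrite /foot -side_lengthZ scalerA mulrVK// unitfE gt_eqF// side_length_gt0.
Qed.

Lemma on_side_ratio i s : on_side i s ->
  0 < (s - side_start i) / side_length i < 1.
Proof.
rewrite /on_side/= in_itv/= => /andP[a b]; have l0 := side_length_gt0 i.
by rewrite divr_gt0 ?subr_gt0//= ltr_pdivrMr// mul1r ltrBlDl.
Qed.

Lemma foot_closed_side i s : on_side i s -> closed_side (vertex Q) i (foot i s).
Proof.
move=> /on_side_ratio /andP[a b]; exists ((s - side_start i) / side_length i).
  by rewrite /= in_itv/= !ltW.
by rewrite foot_vector.
Qed.

Lemma side_vector_scale_inj i (a b : R) : a *: side_vector i = b *: side_vector i -> a = b.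
Proof.
move=> /(congr1 (dot (side_vector i))); rewrite !dotZr.
by apply: mulIf; exact: side_vector_neq0.
Qed.

(** Simplicity settles the nonadjacent pairs. Adjacent sides are linearly independent by the corner
    condition, so their lines meet only at the common vertex. *)
Lemma side_inter i j (x : plane) : i != j ->
  closed_side (vertex Q) i x -> closed_side (vertex Q) j x ->
  (j = ordS i /\ x = vertex Q j) \/ (i = ordS j /\ x = vertex Q i).
Proof.
have adj k x' : closed_side (vertex Q) k x' -> closed_side (vertex Q) (ordS k) x' ->
    x' = vertex Q (ordS k).
  case=> a _ <- [b _]; rewrite -/(side_vector k) -/(side_vector (ordS k)) vertexS => e.
  have {}e : (a - 1) *: side_vector k = b *: side_vector (ordS k).
    by move: e; rewrite -addrA => /addrI e; rewrite scalerBl scale1r -e addrAC subrr add0r.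
  have := congr1 (cross^~ (side_vector (ordS k))) e.
  rewrite !crossZl crossvv mulr0 => /eqP; rewrite mulf_eq0 (negbTE (polygon_corner k)) orbF.
  by rewrite subr_eq0 => /eqP ->; rewrite scale1r.
move=> ij xi xj; have [e|jSi] := eqVneq j (ordS i).
  by left; split => //; rewrite e; apply: adj => //; rewrite -e.
have [e|iSj] := eqVneq i (ordS j).
  by right; split => //; rewrite e; apply: adj => //; rewrite -e.
have : (closed_side (vertex Q) i `&` closed_side (vertex Q) j) x by [].
by rewrite polygon_simple// eq_sym.
Qed.

Lemma foot_neq_vertex i s k : on_side i s -> (k = i) \/ (k = ordS i) -> foot i s != vertex Q k.
Proof.
move=> /on_side_ratio; set r := (_ / _) => /andP[r0 r1] H.
rewrite foot_vector -/r; apply/eqP; case: H => ->.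
  rewrite -[RHS]addr0 => /addrI; rewrite -(scale0r (side_vector i)).
  by move=> /side_vector_scale_inj r00; rewrite r00 ltxx in r0.
rewrite vertexS => /addrI; rewrite -[RHS]scale1r => /side_vector_scale_inj r11.
by rewrite r11 ltxx in r1.
Qed.

Lemma foot_inj i j s s' : on_side i s -> on_side j s' -> foot i s = foot j s' ->
  i = j /\ s = s'.
Proof.
move=> si sj e; have ij : i = j.
  apply/eqP/negPn/negP => ij.
  have xj : closed_side (vertex Q) j (foot i s) by rewrite e; exact: foot_closed_side.
  have [[ej ex]|[ei ex]] := side_inter ij (foot_closed_side si) xj.
    have := @foot_neq_vertex _ _ j si (or_intror ej).
    by rewrite ex eqxx.
  have := @foot_neq_vertex _ _ i sj; rewrite -e ex eqxx => /(_ (or_intror ei)).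
  by [].
split=> //; move: e; rewrite -ij !foot_vector => /addrI /side_vector_scale_inj.
by move=> /divIf; rewrite gt_eqF ?side_length_gt0// => /(_ isT) /addIr.
Qed.

End Polygon.

Section FirstHit.
Context {R : realType} (Q : polygon R).
Local Notation plane := (R^o * R^o)%type.
Local Notation side := 'I_(nsides Q).
Implicit Types (i j k : side) (z : R * R) (d : plane).

Section Direction.
Context (d : plane) (dd : dot d d = 1) (dQ : forall k, cross (side_vector k) d != 0).
Let p k := cross (vertex Q k) d.
Let u k := dot (vertex Q k) d.

Lemma level_diff k : p (ordS k) - p k = cross (side_vector k) d.
Proof. by rewrite /p vertexS crossDl addrC addKr. Qed.

Lemma level_neq k : p k != p (ordS k).
Proof. by rewrite eq_sym -subr_eq0 level_diff. Qed.

Lemma span_ratio k c : spans p k c -> 0 <= (c - p k) / (p (ordS k) - p k) <= 1.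
Proof.
rewrite /spans => h; case/lt_total/orP: (level_neq k) => lt.
  have a : p k <= c.
    by rewrite leNgt; apply/negP => ?; move: h; rewrite leNgt nmulr_rgt0; lra.
  have b : c <= p (ordS k).
    by rewrite leNgt; apply/negP => ?; move: h; rewrite leNgt pmulr_rgt0; lra.
  have D0 : 0 < p (ordS k) - p k by lra.
  by rewrite divr_ge0 ?(ltW D0) ?subr_ge0//= ler_pdivrMr// mul1r lerB.
have a : c <= p k.
  by rewrite leNgt; apply/negP => ?; move: h; rewrite leNgt pmulr_rgt0; lra.
have b : p (ordS k) <= c.
  by rewrite leNgt; apply/negP => ?; move: h; rewrite leNgt nmulr_rgt0; lra.
have -> : (c - p k) / (p (ordS k) - p k) = (p k - c) / (p k - p (ordS k)).
  by rewrite -[LHS]mulrNN -invrN !opprB.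
have D0 : 0 < p k - p (ordS k) by lra.
by rewrite divr_ge0 ?(ltW D0) ?subr_ge0//= ler_pdivrMr// mul1r lerB.
Qed.

Definition side_point k c : plane :=
  vertex Q k + ((c - p k) / (p (ordS k) - p k)) *: side_vector k.

Lemma side_point_closed k c : spans p k c -> closed_side (vertex Q) k (side_point k c).
Proof.
by move=> /span_ratio h; exists ((c - p k) / (p (ordS k) - p k)) => //; rewrite /= in_itv/=.
Qed.

Lemma cross_side_point k c : cross (side_point k c) d = c.
Proof.
rewrite /side_point crossDl crossZl -level_diff mulfVK; last by rewrite level_diff.
by rewrite addrC subrK.
Qed.

Lemma dot_side_point k c : dot (side_point k c) d = chord p u k c.
Proof.
rewrite /side_point dotDl dotZl /chord {2}/u vertexS dotDl.
by rewrite [_ + dot (side_vector k) d - _]addrC addKr.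
Qed.

Lemma side_point_unique k (x : plane) : closed_side (vertex Q) k x ->
  x = side_point k (cross x d).
Proof.
case=> r _ <-; rewrite -/(side_vector k) /side_point level_diff crossDl crossZl.
by rewrite addrAC subrr add0r mulfK.
Qed.

(** On the line of level [c] the position determines the point, so chords that meet come from sides
    that meet. *)
Lemma chords_disjoint i j c : i != j -> spans p i c -> spans p j c ->
  chord p u i c = chord p u j c ->
  (j = ordS i /\ c = p j) \/ (i = ordS j /\ c = p i).
Proof.
move=> ij si sj; rewrite -!dot_side_point => e.
have {e} e : side_point i c = side_point j c.
  by apply: (plane_eq dd e); rewrite !cross_side_point.
have := side_point_closed sj; rewrite -e => xj.
have [[ej ex]|[ei ex]] := side_inter ij (side_point_closed si) xj; [left|right];
  by split=> //; rewrite /p -ex cross_side_point.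
Qed.

Lemma next_exit_side i c : (forall k, p k != c) -> p i < c < p (ordS i) ->
  exists j, [/\ p (ordS j) < c < p j, chord p u i c < chord p u j c &
    forall k, inside p k c -> chord p u i c < chord p u k c ->
      chord p u j c <= chord p u k c].
Proof.
move=> pc ic; have [h hP] := left_value_cst level_neq chords_disjoint.
apply: (next_exit level_neq chords_disjoint pc hP) => //.
apply: (left_value1 level_neq chords_disjoint i hP).
have := polygon_ccw Q; congr (_ < _); apply: eq_bigr => j _.
by rewrite -(cross_dot_cross _ _ dd).
Qed.

End Direction.

(* [lineval i z k] is the signed distance of vertex k to the line of flight
   of z; it is positive when the vertex lies to the right of that line. *)
Definition lineval i z k : R :=
  cross (vertex Q k - foot i z.1) (direction i z.2).

(** Vertices are tested against the whole line, beyond the segment that is flown. The points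
    excluded form a null set, and the sweep applies along the line in full. *)
Definition generic i z : Prop :=
  [/\ on_side i z.1, 0 < z.2 < pi, forall k, lineval i z k != 0 &
      forall k, cross (side_vector k) (direction i z.2) != 0].

Definition hits i z j s t : Prop :=
  [/\ 0 < t, on_side j s, foot j s = foot i z.1 + t *: direction i z.2 &
      forall r, 0 < r < t -> ~ boundary Q (foot i z.1 + r *: direction i z.2)].

Lemma hits_unique i z j s t j' s' t' : hits i z j s t -> hits i z j' s' t' ->
  [/\ j = j', s = s' & t = t'].
Proof.
have bd k r : on_side k r -> boundary Q (foot k r).
  by move=> kr; exists k => //; exact: foot_closed_side.
move=> [t0 js e H] [t0' js' e' H'].
have tt : t = t'.
  apply/eqP; rewrite eq_le !leNgt; apply/andP; split; apply/negP => lt.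
    by apply: (H t'); [rewrite t0' lt|rewrite -e'; exact: bd].
  by apply: (H' t); [rewrite t0 lt|rewrite -e; exact: bd].
by have [] := foot_inj js js'; rewrite ?e ?e' ?tt.
Qed.

Lemma lineval_level i z k :
  lineval i z k = cross (vertex Q k) (direction i z.2) - cross (foot i z.1) (direction i z.2).
Proof. by rewrite /lineval crossBl. Qed.

Lemma lineval_on_side i z : on_side i z.1 -> 0 < z.2 < pi ->
  lineval i z i < 0 /\ 0 < lineval i z (ordS i).
Proof.
move=> /on_side_ratio; set r := (_ / _) => /andP[r0 r1] /andP[t0 tp].
have st : 0 < cross (side_vector i) (direction i z.2).
  rewrite -side_lengthZ crossZl cross_tangent_direction.
  by rewrite mulr_gt0 ?side_length_gt0// sin_gt0_pi// t0.
rewrite !lineval_level vertexS foot_vector -/r.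
move: (side_vector i) (vertex Q i) st => e v st; rewrite !crossDl crossZl.
have := mulr_gt0 r0 st; have : 0 < (1 - r) * cross e (direction i z.2).
  by rewrite mulr_gt0// subr_gt0.
by move=> ? ?; split; lra.
Qed.

(** The direction points inward, so side [i] rises through the level of the line; by alternation the
    next side met falls. This sign is kept in the conclusion because it makes the reflected
    direction point inward again. *)
Lemma generic_hits i z : generic i z -> exists j s t,
  hits i z j s t /\ cross (side_vector j) (direction i z.2) < 0.
Proof.
move=> [zi zt zv dQ]; set d := direction i z.2; set x0 := foot i z.1.
have dd : dot d d = 1 by exact: dot_direction.
set c := cross x0 d; pose p k := cross (vertex Q k) d; pose u k := dot (vertex Q k) d.
have pc k : p k != c by rewrite -subr_eq0 -crossBl; exact: zv.
have ic : p i < c < p (ordS i).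
  have [] := lineval_on_side zi zt; rewrite !lineval_level -/d -/x0 -/c -/(p i) -/(p (ordS i)).
  by rewrite subr_lt0 subr_gt0 => -> ->.
have [j [/andP[jc1 jc2] ij jmin]] := next_exit_side dd dQ pc ic.
have x0E : x0 = side_point d i c.
  by apply: side_point_unique => //; exact: foot_closed_side.
have ui : chord p u i c = dot x0 d by rewrite x0E dot_side_point.
have dj : cross (side_vector j) d < 0 by rewrite -level_diff subr_lt0 (lt_trans jc1).
set a := (c - p j) / (p (ordS j) - p j).
have a01 : 0 < a < 1.
  have -> : a = (p j - c) / (p j - p (ordS j)).
    by rewrite /a -[LHS]mulrNN -invrN !opprB.
  have D0 : 0 < p j - p (ordS j) by rewrite subr_gt0 (lt_trans jc1).
  apply/andP; split; first by rewrite divr_gt0 ?D0 ?subr_gt0.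
  by rewrite ltr_pdivrMr// mul1r ltrD2l ltrN2.
pose s := side_start j + a * side_length j.
have sj : on_side j s.
  rewrite /on_side/= in_itv/= /s ltrDl ltrD2l; case/andP: a01 => a0 a1.
  by rewrite mulr_gt0 ?side_length_gt0// -[X in _ < X]mul1r ltr_pM2r ?side_length_gt0.
have fs : foot j s = side_point d j c.
  rewrite foot_vector /side_point -/(p j) -/(p (ordS j)) -/a /s.
  by rewrite [side_start j + _]addrC addrK mulfK// gt_eqF// side_length_gt0.
set t := chord p u j c - chord p u i c.
have on_line r : dot (x0 + r *: d) d = dot x0 d + r /\ cross (x0 + r *: d) d = c.
  by rewrite dotDl crossDl dotZl crossZl dd crossvv mulr1 mulr0 addr0.
exists j, s, t; split=> //; split=> //.
- by rewrite /t subr_gt0.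
- rewrite fs; have [h1 h2] := on_line t; apply: (plane_eq dd).
    by rewrite dot_side_point h1 -ui /t addrC subrK.
  by rewrite h2 cross_side_point.
(* A boundary point met earlier lies on a side that the line crosses strictly, with a chord between
   those of [i] and [j]. *)
move=> r /andP[r0 rt] [k _ xk].
have [h1 h2] := on_line r.
have xE := side_point_unique dQ xk; rewrite h2 in xE.
have uk : chord p u k c = chord p u i c + r by rewrite -dot_side_point -xE h1 ui.
have kin : inside p k c.
  have : spans p k c.
    case: xk => b /=; rewrite in_itv/= => /andP[b0 b1] xb.
    have : cross (vertex Q k + b *: edge (vertex Q) k) d = c by rewrite xb.
    rewrite -/(side_vector k) crossDl crossZl -level_diff -/(p k) -/(p (ordS k)) => <-.
    rewrite /spans; set D := p (ordS k) - p k.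
    have -> : (p k + b * D - p k) * (p k + b * D - p (ordS k)) = - (b * (1 - b) * D ^+ 2).
      by rewrite /D; ring.
    by rewrite oppr_le0 mulr_ge0// ?sqr_ge0// mulr_ge0// subr_ge0.
  rewrite /spans /inside lt_neqAle => ->; rewrite andbT mulf_eq0 !subr_eq0.
  by rewrite ![c == _]eq_sym (negbTE (pc k)) (negbTE (pc (ordS k))).
have := jmin k kin; rewrite uk ltrDl r0 => /(_ isT).
by move: rt; rewrite /t; lra.
Qed.

End FirstHit.

(** * The first side hit is determined by the position of the vertices *)

Section Order.
Context {R : realType} (Q : polygon R).
Local Notation plane := (R^o * R^o)%type.
Local Notation side := 'I_(nsides Q).
Implicit Types (i j k : side) (z : R * R) (d : plane).

Lemma plane_cramer (e f w : plane) : cross e f != 0 ->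
  w = (cross w f / cross e f) *: e - (- (cross e w / cross e f)) *: f.
Proof.
case: e f w => [e1 e2] [f1 f2] [w1 w2] D0.
apply/pair_equal_spec; split; move: D0; rewrite /cross /= /GRing.scale /= => D0; field; exact: D0.
Qed.

(* Two sides do not cross, so the line carrying one of them leaves the other
   one on one side. *)
Lemma side_not_separated i j : i != j ->
  0 <= cross (side_vector i) (vertex Q j - vertex Q i) *
       cross (side_vector i) (vertex Q (ordS j) - vertex Q i) \/
  0 <= cross (side_vector j) (vertex Q i - vertex Q j) *
       cross (side_vector j) (vertex Q (ordS i) - vertex Q j).
Proof.
move=> ij.
case: leP => [|f0]; first by left.
case: leP => [|g0]; first by right.
(* Otherwise the line of each side strictly separates the ends of the other; by Cramer's rule the
   two lines meet strictly inside both sides. *)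
exfalso; move: f0 g0; rewrite !vertexS.
set e := side_vector i; set f := side_vector j; set w := vertex Q j - vertex Q i.
have -> : vertex Q j + f - vertex Q i = w + f by rewrite addrAC.
have -> : vertex Q i - vertex Q j = - w by rewrite opprB.
have -> : vertex Q i + e - vertex Q j = e - w by rewrite addrAC -opprB addrC.
rewrite crossDr crossBr.
have -> : cross f (- w) = cross w f by rewrite /cross /=; ring.
have -> : cross f e = - cross e f by rewrite crossC.
rewrite [cross f w]crossC opprK.
set K := cross e f; set a := cross e w; set b := cross w f => f0 g0.
have K0 : K != 0.
  by apply: contraTneq f0 => ->; rewrite addr0 -leNgt -expr2 sqr_ge0.
have ratio (x : R) : x * (x + - K) < 0 -> 0 < x / K < 1.
  move=> h; case/lt_total/orP: K0 => K0.
    have x0 : x < 0.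
      by rewrite ltNge; apply/negP => ?; have := mulr_ge0 (_ : 0 <= x) (_ : 0 <= x - K); lra.
    have xK : K < x.
      by rewrite ltNge; apply/negP => ?; have := mulr_le0 (_ : x <= 0) (_ : x - K <= 0); lra.
    by rewrite -mulrNN -invrN divr_gt0 ?oppr_gt0//= ltr_pdivrMr ?oppr_gt0// mul1r ltrN2.
  have x0 : 0 < x.
    by rewrite ltNge; apply/negP => ?; have := mulr_le0 (_ : x <= 0) (_ : x - K <= 0); lra.
  have xK : x < K.
    by rewrite ltNge; apply/negP => ?; have := mulr_ge0 (_ : 0 <= x) (_ : 0 <= x - K); lra.
  by rewrite divr_gt0//= ltr_pdivrMr// mul1r.
rewrite [- K + b]addrC in g0.
have /andP[r0 r1] := ratio b g0.
have /andP[s0 s1] : 0 < - (a / K) < 1.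
  by rewrite -mulNr; apply: ratio; rewrite -opprD mulrNN.
pose x := vertex Q i + (b / K) *: e.
have xE : x = vertex Q j + (- (a / K)) *: f.
  have we := plane_cramer w K0; rewrite -/a -/b -/K in we.
  have -> : vertex Q j = vertex Q i + w by rewrite /w addrC subrK.
  by rewrite {1}we -addrA subrK.
have xi : closed_side (vertex Q) i x by exists (b / K) => //; rewrite /= in_itv/= !ltW.
have xj : closed_side (vertex Q) j x by exists (- (a / K)) => //; rewrite /= in_itv/= !ltW.
have [[_]|[_]] := side_inter ij xi xj.
  rewrite xE -[RHS]addr0 => /addrI; rewrite -(scale0r f) => /side_vector_scale_inj h.
  by rewrite h ltxx in s0.
rewrite /x -[RHS]addr0 => /addrI; rewrite -(scale0r e) => /side_vector_scale_inj h.
by rewrite h ltxx in r0.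
Qed.

Lemma cross_closed_side i (e y : plane) (x : plane) : closed_side (vertex Q) i x ->
  exists2 r, 0 <= r <= 1 &
    cross e (x - y) = (1 - r) * cross e (vertex Q i - y) + r * cross e (vertex Q (ordS i) - y).
Proof.
case=> r; rewrite /= in_itv/= => r01 <-; exists r => //.
by rewrite -/(side_vector i) vertexS !(crossBr, crossDr, crossZr); ring.
Qed.

Lemma cross_closed_side_same_sign i (e y x x' : plane) :
  0 <= cross e (vertex Q i - y) * cross e (vertex Q (ordS i) - y) ->
  closed_side (vertex Q) i x -> closed_side (vertex Q) i x' ->
  0 <= cross e (x - y) * cross e (x' - y).
Proof.
move=> H /(cross_closed_side e y)[r /andP[r0 r1] ->] /(cross_closed_side e y)[s /andP[s0 s1] ->].
set a := cross e _ in H *; set b := cross e _ in H *.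
have -> : ((1 - r) * a + r * b) * ((1 - s) * a + s * b) =
  (1 - r) * (1 - s) * a ^+ 2 + r * s * b ^+ 2 + ((1 - r) * s + r * (1 - s)) * (a * b) by ring.
have r1' : 0 <= 1 - r by lra.
have s1' : 0 <= 1 - s by lra.
apply: addr_ge0; last by rewrite mulr_ge0// addr_ge0// mulr_ge0.
by apply: addr_ge0; apply: mulr_ge0; rewrite ?sqr_ge0// mulr_ge0.
Qed.

(** Measured by the cross product with [side_vector i], the deviation from the line of side [i]
    grows from [a] at a constant rate, so at side [j] it is [t] times that rate. If [j] stays on one
    side of that line, the deviations of both trajectories have the same sign; otherwise [i] stays
    on one side of the line of [j] and the roles are exchanged. *)
Lemma crossing_order i j (a a' d d' : plane) (t t' : R) : i != j ->
  closed_side (vertex Q) i a -> closed_side (vertex Q) i a' ->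
  closed_side (vertex Q) j (a + t *: d) -> closed_side (vertex Q) j (a' + t' *: d') ->
  0 < cross (side_vector i) d * cross (side_vector i) d' ->
  0 < cross (side_vector j) d * cross (side_vector j) d' ->
  0 <= t * t'.
Proof.
move=> ij ai ai' bj bj' di dj.
have on_line k x : closed_side (vertex Q) k x ->
    cross (side_vector k) (x - vertex Q k) = 0.
  by case=> r _ <-; rewrite -/(side_vector k) addrAC subrr add0r crossZr crossvv mulr0.
have E (e v x y : plane) (r : R) :
    cross e (x + r *: y - v) = cross e (x - v) + r * cross e y.
  by rewrite /cross /= /GRing.scale /=; ring.
have [H|H] := side_not_separated ij.
  have := cross_closed_side_same_sign H bj bj'.
  rewrite !E (on_line _ _ ai) (on_line _ _ ai') !add0r.
  by rewrite mulrACA pmulr_lge0.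
have := cross_closed_side_same_sign H ai ai'.
have /eqP := on_line _ _ bj; rewrite E addr_eq0 => /eqP ->.
have /eqP := on_line _ _ bj'; rewrite E addr_eq0 => /eqP ->.
by rewrite mulrNN mulrACA pmulr_lge0.
Qed.

Definition same_signs i z w : Prop :=
  forall k, (0 < lineval i z k) = (0 < lineval i w k).

Definition first_hit i j z : Prop := generic i z /\ exists s t, hits i z j s t.

Lemma first_hit_exists i z : generic i z -> exists j, first_hit i j z.
Proof.
by move=> gz; have [j [s [t [h _]]]] := generic_hits gz; exists j; split=> //; exists s, t.
Qed.

Lemma hits_exit i z j s t : generic i z -> hits i z j s t ->
  cross (side_vector j) (direction i z.2) < 0.
Proof.
move=> gz h; have [j' [s' [t' [h' c]]]] := generic_hits gz.
by have [->] := hits_unique h h'.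
Qed.

Lemma lineval_diff i z k :
  lineval i z (ordS k) - lineval i z k = cross (side_vector k) (direction i z.2).
Proof. by rewrite !lineval_level vertexS crossDl; ring. Qed.

(** The parameter [r] carries no sign: the crossing may lie behind the foot point. *)
Lemma crossed_point i z k : generic i z ->
  lineval i z k * lineval i z (ordS k) < 0 ->
  exists r, closed_side (vertex Q) k (foot i z.1 + r *: direction i z.2).
Proof.
move=> [zi zt zv dQ] h; set d := direction i z.2; set x0 := foot i z.1.
have dd : dot d d = 1 by exact: dot_direction.
exists (dot (side_point d k (cross x0 d)) d - dot x0 d).
set r := _ - _.
have -> : x0 + r *: d = side_point d k (cross x0 d).
  apply: (plane_eq dd).
    by rewrite dotDl dotZl dd mulr1 /r addrC subrK.
  by rewrite cross_side_point// crossDl crossZl crossvv mulr0 addr0.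
apply: side_point_closed => //.
move: h; rewrite !lineval_level -/d -/x0 /spans => /ltW.
by rewrite -mulrNN !opprB.
Qed.

Lemma point_crossed i z k r : generic i z ->
  closed_side (vertex Q) k (foot i z.1 + r *: direction i z.2) ->
  lineval i z k * lineval i z (ordS k) < 0.
Proof.
move=> [zi zt zv dQ] /(cross_closed_side (direction i z.2) (foot i z.1))[s s01].
rewrite addrAC subrr add0r crossZr crossvv mulr0 => e.
have lE m : cross (direction i z.2) (vertex Q m - foot i z.1) = - lineval i z m.
  by rewrite crossC.
move: e; rewrite !lE; have := zv k; have := zv (ordS k).
move: (lineval i z k) (lineval i z (ordS k)) => a b b0 a0 e.
rewrite lt_neqAle mulf_neq0//= leNgt; apply/negP => ab.
have /andP[s0 s1] := s01.
have : (1 - s) * a ^+ 2 + s * (a * b) = 0.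
  transitivity (- a * ((1 - s) * - a + s * - b)); first ring.
  by rewrite -e mulr0.
have a2 : 0 < a ^+ 2 by rewrite exprn_even_gt0.
have h1 : 0 <= (1 - s) * a ^+ 2 by rewrite mulr_ge0 ?(ltW a2)// subr_ge0.
have h2 : 0 <= s * (a * b) by rewrite mulr_ge0// ltW.
move=> h3; have /eqP : (1 - s) * a ^+ 2 = 0 by lra.
rewrite mulf_eq0 (gt_eqF a2) orbF => /eqP h4.
by have : s * (a * b) = 0; [lra|rewrite (_ : s = 1); lra].
Qed.

Section Stability.
Context (i : side) (z w : R * R) (gz : generic i z) (gw : generic i w).
Context (zw : same_signs i z w).

Lemma same_signs_gt0 k : 0 < lineval i z k * lineval i w k.
Proof.
have [_ _ zv _] := gz; have [_ _ wv _] := gw.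
have := zw k; have := zv k; have := wv k.
case/lt_total/orP => a /lt_total/orP[] b; rewrite ?a ?b => h.
- by rewrite nmulr_rgt0.
- by move: h; rewrite ltNge (ltW a).
- by move: h; rewrite ltNge (ltW b).
- by rewrite mulr_gt0.
Qed.

Lemma same_signs_crossed k : lineval i z k * lineval i z (ordS k) < 0 ->
  lineval i w k * lineval i w (ordS k) < 0 /\
  0 < cross (side_vector k) (direction i z.2) * cross (side_vector k) (direction i w.2).
Proof.
rewrite -!lineval_diff; have := same_signs_gt0 k; have := same_signs_gt0 (ordS k).
move: (lineval i z k) (lineval i z (ordS k)) (lineval i w k) (lineval i w (ordS k)).
move=> a b c d bd ac ab.
have cd : c * d < 0.
  have : (a * c) * (b * d) = (a * b) * (c * d) by ring.
  have := mulr_gt0 ac bd => + e; rewrite e.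
  by rewrite nmulr_rgt0.
split=> //.
have : (a * d) * (a * c) = a ^+ 2 * (c * d) by ring.
have : (b * c) * (a * c) = c ^+ 2 * (a * b) by ring.
move=> e1 e2.
have h1 : b * c <= 0.
  rewrite -(pmulr_lle0 _ ac) e1 mulr_ge0_le0// ?sqr_ge0//; exact: ltW.
have h2 : a * d <= 0.
  rewrite -(pmulr_lle0 _ ac) e2 mulr_ge0_le0// ?sqr_ge0//; exact: ltW.
have -> : (b - a) * (d - c) = b * d + a * c - b * c - a * d by ring.
lra.
Qed.

Lemma foot_notin_side j k s : on_side j s -> j != k -> ~ closed_side (vertex Q) k (foot j s).
Proof.
move=> js jk H; have [[e ex]|[e ex]] := side_inter jk (foot_closed_side js) H.
  by have := foot_neq_vertex js (or_intror e); rewrite ex eqxx.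
by have := foot_neq_vertex js (or_introl (erefl j)); rewrite ex eqxx.
Qed.

End Stability.

Lemma hits_side_neq i z j s t : generic i z -> hits i z j s t -> i != j.
Proof.
move=> gz h; have := hits_exit gz h; apply: contraTneq => <-.
have [zi zt _ _] := gz; have [a b] := lineval_on_side zi zt.
by rewrite -lineval_diff -leNgt; lra.
Qed.

(** Both lines cross [i] and [j'] in the same directions, so [r] is nonnegative like [t'] by
    [crossing_order]. If moreover [r < t], side [j'] would be met before the first hit of [z]. *)
Lemma hits_not_after i z w j s t j' s' t' r : generic i z -> generic i w ->
  same_signs i z w -> hits i z j s t -> hits i w j' s' t' ->
  closed_side (vertex Q) j' (foot i z.1 + r *: direction i z.2) -> t <= r.
Proof.
move=> gz gw zw hz hw xj'.
have [zi zt _ _] := gz; have [wi wt _ _] := gw.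
have ij' := hits_side_neq gw hw.
have [t'0 js' ew _] := hw; have [t0 js ez bz] := hz.
have [_ dj'] := same_signs_crossed gz gw zw (point_crossed gz xj').
have [a b] := lineval_on_side zi zt; have [a' b'] := lineval_on_side wi wt.
have di : 0 < cross (side_vector i) (direction i z.2) * cross (side_vector i) (direction i w.2).
  by rewrite -!lineval_diff mulr_gt0; lra.
have := crossing_order ij' (foot_closed_side zi) (foot_closed_side wi) xj' _ di dj'.
move=> /(_ t'); rewrite -ew => /(_ (foot_closed_side js')); rewrite pmulr_lge0// => r0.
have r1 : 0 < r.
  rewrite lt0r r0 andbT; apply/eqP => r00; move: xj'; rewrite r00 scale0r addr0.
  exact: foot_notin_side.
rewrite leNgt; apply/negP => rt; apply: (bz r); first by rewrite r1.
by exists j'.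
Qed.

(** If the first sides [j] and [j'] differed, the line of [z] would meet [j] before [j'] and that of
    [w] would meet [j'] before [j], against [crossing_order]. A tie would put a foot point on two
    sides. *)
Lemma first_hit_stable i j z w : generic i w -> same_signs i z w ->
  first_hit i j z -> first_hit i j w.
Proof.
move=> gw zw [gz [s [t hz]]].
have wz : same_signs i w z by move=> k; rewrite zw.
have [j' [_ [s' [t' hw]]]] := first_hit_exists gw.
have [->|jj'] := eqVneq j j'; first by split=> //; exists s', t'.
exfalso; have [t0 js ez _] := hz; have [t'0 js' ew _] := hw.
have xj : closed_side (vertex Q) j (foot i z.1 + t *: direction i z.2).
  by rewrite -ez; exact: foot_closed_side.
have xj' : closed_side (vertex Q) j' (foot i w.1 + t' *: direction i w.2).
  by rewrite -ew; exact: foot_closed_side.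
have [cw dj] := same_signs_crossed gz gw zw (point_crossed gz xj).
have [cz dj'] := same_signs_crossed gw gz wz (point_crossed gw xj').
have [r xr] := crossed_point gz cz; have [r' xr'] := crossed_point gw cw.
have tr := hits_not_after gz gw zw hz hw xr.
have tr' := hits_not_after gw gz wz hw hz xr'.
have := @crossing_order j j' _ _ _ _ (r - t) (t' - r') jj' xj xr' _ _ dj.
have shift (x d : plane) (a b : R) : x + a *: d + (b - a) *: d = x + b *: d.
  by rewrite -addrA -scalerDl [a + _]addrC subrK.
rewrite !shift => /(_ xr xj').
rewrite mulrC in dj'; move=> /(_ dj') h.
have : (r - t) * (t' - r') = 0.
  by apply/eqP; rewrite eq_le h andbT mulr_ge0_le0; lra.
move=> /eqP; rewrite mulf_eq0 !subr_eq0 => /orP[/eqP e|/eqP e].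
  by apply: (foot_notin_side js jj'); rewrite ez -e.
by rewrite eq_sym in jj'; apply: (foot_notin_side js' jj'); rewrite ew e.
Qed.

End Order.

(** * The billiard map *)

Section Angles.
Context {R : realType}.
Implicit Types (x y : R).

Lemma cos_sin_inj x y : 0 < x < 2 * pi -> 0 < y < 2 * pi ->
  cos x = cos y -> sin x = sin y -> x = y.
Proof.
suff H (a b : R) : 0 < a < 2 * pi -> 0 < b < 2 * pi -> a < b ->
    cos a = cos b -> sin a = sin b -> False.
  move=> hx hy c s; apply/eqP/negPn/negP => /lt_total/orP[xy|yx].
    exact: (H x y hx hy xy c s).
  exact: (H y x hy hx yx (esym c) (esym s)).
move=> /andP[a0 a1] /andP[b0 b1] ab c s.
have s0 : 0 < sin ((b - a) / 2).
  by apply: sin_gt0_pi; apply/andP; split; lra.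
have : cos (b - a) = 1 by rewrite cosB c s -!expr2 cos2Dsin2.
have -> : b - a = (b - a) / 2 + (b - a) / 2 by rewrite -splitr.
rewrite cosD -!expr2 cos2sin2 => h.
have : sin ((b - a) / 2) ^+ 2 = 0 by lra.
by move=> /eqP; rewrite sqrf_eq0 gt_eqF.
Qed.

End Angles.

Section Step.
Context {R : realType} (Q : polygon R).
Local Notation plane := (R^o * R^o)%type.
Local Notation side := 'I_(nsides Q).
Implicit Types (i j k : side) (z w : R * R) (d : plane).

Lemma side_start_lt i j : (i < j)%N -> side_start i + side_length i <= side_start j.
Proof.
move=> ij; rewrite /side_start [leRHS](bigID (fun k : side => (k < i)%N))/=.
apply: lerD.
  rewrite le_eqVlt; apply/orP; left; apply/eqP; apply: eq_bigl => k.
  by rewrite andb_idl// => /ltn_trans; apply.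
rewrite (bigD1 i)/=; last by rewrite ij ltnn.
by rewrite lerDl sumr_ge0// => k _; rewrite ltW// side_length_gt0.
Qed.

Lemma on_side_inj i j (s : R) : on_side i s -> on_side j s -> i = j.
Proof.
rewrite /on_side/= !in_itv/= => /andP[a b] /andP[c e].
case: (ltngtP i j) => [/side_start_lt h|/side_start_lt h|/val_inj//].
  by have := lt_trans (lt_le_trans b h) c; rewrite ltxx.
by have := lt_trans (lt_le_trans e h) a; rewrite ltxx.
Qed.

Lemma reflect_dot j d d' : dot (reflect_in j d) (reflect_in j d') = dot d d'.
Proof.
rewrite /reflect_in; move: (inner_normal j) (dot_normal j) => n nn.
rewrite !(dotBl, dotBr, dotZl, dotZr) nn [dot n d']dotC; ring.
Qed.

Lemma reflect_normal j d : dot (reflect_in j d) (inner_normal j) = - dot d (inner_normal j).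
Proof.
rewrite /reflect_in; move: (inner_normal j) (dot_normal j) => n nn.
rewrite dotBl dotZl nn; ring.
Qed.

Lemma reflect_tangent j d : dot (reflect_in j d) (tangent j) = dot d (tangent j).
Proof.
rewrite /reflect_in dotBl dotZl [dot (inner_normal j) _]dotC dot_tangent_normal; ring.
Qed.

Lemma dot_normal_cross j d : dot d (inner_normal j) = cross (tangent j) d.
Proof. exact: dot_rot90r. Qed.

Lemma direction_exists j d : dot d d = 1 -> 0 < cross (tangent j) d ->
  exists2 th, 0 < th < pi & direction j th = d.
Proof.
move=> dd c0; pose x := dot (tangent j) d.
have e1 : x ^+ 2 + cross (tangent j) d ^+ 2 = 1.
  rewrite /x -[RHS]mulr1 -{1}(dot_tangent j) -dd /dot /cross; ring.
have x1 : -1 < x < 1.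
  rewrite -ltr_norml -(ltr_pXn2r (_ : (0 < 2)%N)) ?nnegrE// expr1n -normrX.
  by rewrite ger0_norm ?sqr_ge0//; have : 0 < cross (tangent j) d ^+ 2; [rewrite exprn_gt0|lra].
have /andP[x1a x1b] := x1.
have x1' : -1 <= x <= 1 by rewrite !ltW.
exists (acos x); first by rewrite acos_gt0 ?acos_ltpi ?ltW// ?x1a ?x1b ?(ltW x1a) ?(ltW x1b).
apply: (plane_eq (dot_tangent j)).
  by rewrite dotC dot_tangent_direction acosK// dotC.
rewrite [LHS]crossC cross_tangent_direction sin_acos// [RHS]crossC; congr (- _).
have -> : 1 - x ^+ 2 = cross (tangent j) d ^+ 2 by rewrite -e1; ring.
by rewrite sqrtr_sqr ger0_norm ?ltW.
Qed.

Definition step z z' : Prop := exists i j t,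
  [/\ generic i z, hits i z j z'.1 t, 0 < z'.2 < pi &
      direction j z'.2 = reflect_in j (direction i z.2)].

Lemma tangent_exit i z j s t : generic i z -> hits i z j s t ->
  cross (tangent j) (direction i z.2) < 0.
Proof.
move=> gz h; have := hits_exit gz h; rewrite -side_lengthZ crossZl.
by rewrite pmulr_rlt0// side_length_gt0.
Qed.

Lemma step_exists i z : generic i z -> exists z', step z z'.
Proof.
move=> gz; have [j [_ [s [t h]]]] := first_hit_exists gz.
have [||th th0 e] := @direction_exists j (reflect_in j (direction i z.2)).
- by rewrite reflect_dot dot_direction.
- by rewrite -dot_normal_cross reflect_normal dot_normal_cross oppr_gt0 (tangent_exit gz h).
by exists (s, th), i, j, t; split.
Qed.

Lemma step_billiard z z' : step z z' -> billiard_map Q z z'.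
Proof.
case=> i [j [t [[zi zt zv dQ] [t0 js e b] th0 de]]].
split; [by split => //; exists i|by split => //; exists j|].
by exists i, j; split=> //; exists t.
Qed.

(** A point without successor is sent to itself by default; results on this map are therefore
    confined to generic points. *)
Definition billiard_next z : R * R := xget z [set z' | step z z'].

Lemma billiard_next_step i z : generic i z -> step z (billiard_next z).
Proof. by move=> /step_exists[z' zz']; exact: (@xgetI _ z [set z' | step z z'] z' zz'). Qed.

Lemma step_first_hit i j z z' : first_hit i j z -> step z z' -> exists t,
  [/\ generic i z, hits i z j z'.1 t, 0 < z'.2 < pi &
      direction j z'.2 = reflect_in j (direction i z.2)].
Proof.
move=> [gz [s [t h]]] [i' [j' [t' [gz' h' th0 e]]]].
have ii : i = i' by case: gz gz' => zi _ _ _ [zi' _ _ _]; exact: on_side_inj zi'.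
rewrite -ii in h' gz' e; have [jj ss tt] := hits_unique h h'.
by exists t'; rewrite jj; split.
Qed.

(** A reflection reverses orientation, so it is the sum of the two angles, and not their difference,
    that equals the angle between the tangents modulo [2 * pi]. The range of the sum removes the
    ambiguity. *)
Lemma step_angle i j z z' : first_hit i j z -> step z z' ->
  [/\ 0 < z.2 + z'.2 < 2 * pi, cos (z.2 + z'.2) = dot (tangent i) (tangent j) &
      sin (z.2 + z'.2) = cross (tangent i) (tangent j)].
Proof.
move=> hz /(step_first_hit hz)[t [[_ /andP[t0 t1] _ _] _ /andP[t'0 t'1] e]].
have c' : cos z'.2 = dot (direction i z.2) (tangent j).
  by rewrite -reflect_tangent -e dotC dot_tangent_direction.
have s' : sin z'.2 = - dot (direction i z.2) (inner_normal j).
  by rewrite -reflect_normal -e dot_normal_cross cross_tangent_direction.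
split; first by apply/andP; split; lra.
  rewrite cosD c' s' /direction /inner_normal.
  have : cos z.2 ^+ 2 + sin z.2 ^+ 2 = 1 by exact: cos2Dsin2.
  move: (tangent i) (tangent j) (cos z.2) (sin z.2) => f g c s cs.
  rewrite -[RHS]mul1r -cs /dot /rot90 /= /GRing.scale /=; ring.
rewrite sinD c' s' /direction /inner_normal.
have : cos z.2 ^+ 2 + sin z.2 ^+ 2 = 1 by exact: cos2Dsin2.
move: (tangent i) (tangent j) (cos z.2) (sin z.2) => f g c s cs.
rewrite -[RHS]mul1r -cs /dot /cross /rot90 /= /GRing.scale /=; ring.
Qed.

Lemma angle_sum i j : exists c, forall z z', first_hit i j z -> step z z' ->
  z'.2 = c - z.2.
Proof.
(* The constant is read off from any one hit, if there is one. *)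
have [[[z z'] [hz zz']]|H] := pselect (exists zz : (R * R) * (R * R),
    first_hit i j zz.1 /\ step zz.1 zz.2); last first.
  by exists 0 => z z' hz zz'; exfalso; apply: H; exists (z, z').
exists (z.2 + z'.2) => w w' hw ww'.
have [a b c] := step_angle hz zz'; have [a' b' c'] := step_angle hw ww'.
rewrite (cos_sin_inj a a') ?b ?c//; ring.
Qed.

(** Taking the cross product of the hitting equation with the direction of flight eliminates the
    time of flight. *)
Lemma step_foot i j z z' : first_hit i j z -> step z z' ->
  z'.1 = side_start j + (cross (vertex Q j - vertex Q i) (direction i z.2)
           - (z.1 - side_start i) * sin z.2) / sin z'.2.
Proof.
move=> hz /(step_first_hit hz)[t [gz [_ _ e _] /andP[t0 t1] de]].
have s0 : 0 < sin z'.2 by rewrite sin_gt0_pi// t0.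
have := congr1 (cross^~ (direction i z.2)) e; rewrite /foot.
have ct : cross (tangent j) (direction i z.2) = - sin z'.2.
  have := cross_tangent_direction j z'.2.
  by rewrite de -dot_normal_cross reflect_normal dot_normal_cross => <-; rewrite opprK.
rewrite [in RHS]crossDl [cross (t *: _) _]crossZl crossvv mulr0 addr0.
rewrite [LHS]crossDl [RHS]crossDl ![cross (_ *: tangent _) _]crossZl ct cross_tangent_direction.
rewrite crossBl => h; apply: (@addrI _ (- side_start j)); rewrite [in RHS]addKr addrC.
by apply: (canRL (mulfK _)); [rewrite gt_eqF|lra].
Qed.

Lemma generic_phase_space i z : generic i z -> phase_space Q z.
Proof. by case=> zi zt _ _; split=> //; exists i. Qed.

Lemma step_phase_space z z' : step z z' -> phase_space Q z'.
Proof. by move=> /step_billiard[]. Qed.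

End Step.

(** * Invariance of the Liouville measure *)

Section AffineChange.
Context {R : realType}.
Local Open Scope ereal_scope.
Local Notation mu := (@lebesgue_measure R).

Lemma measurable_affine (a b : R) :
  measurable_fun [set: R] (fun s : R => a + b * s : measurableTypeR R)%R.
Proof.
apply: measurable_funD => //; apply: measurable_funM => //.
Qed.

Lemma lebesgue_measure_affine_itv (a b x y : R) : b != 0%R ->
  mu `]x, y]%classic = `|b|%:E * mu ((fun s => a + b * s)%R @^-1` `]x, y]%classic).
Proof.
move=> b0; have [bp|bn] : (0 < b)%R \/ (b < 0)%R.
    by case/lt_total/orP: b0; [right|left].
  have -> : (fun s => a + b * s)%R @^-1` `]x, y]%classic =
      `]((x - a) / b)%R, ((y - a) / b)%R]%classic.
    apply/seteqP; split=> s; rewrite /= !in_itv/= ltr_pdivrMr// ler_pdivlMr//;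
      by rewrite ltrBlDl lerBrDl mulrC.
  rewrite !lebesgue_measure_itv/= !lte_fin ltr_pM2r ?invr_gt0// ltrD2r.
  case: ifP => _; last by rewrite mule0.
  rewrite -!EFinB -EFinM; congr (_%:E); rewrite gtr0_norm//.
  by field; rewrite gt_eqF.
have -> : (fun s => a + b * s)%R @^-1` `]x, y]%classic =
    `[((y - a) / b)%R, ((x - a) / b)%R[%classic.
  apply/seteqP; split=> s; rewrite /= !in_itv/= ler_ndivrMr// ltr_ndivlMr//;
    by rewrite ltrBlDl lerBrDl mulrC andbC.
rewrite !lebesgue_measure_itv/= !lte_fin ltr_nM2r ?invr_lt0// ltrD2r.
case: ifP => _; last by rewrite mule0.
rewrite -!EFinB -EFinM; congr (_%:E); rewrite ltr0_norm//.
by field; rewrite lt_eqF.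
Qed.

(** The rescaled image measure agrees with Lebesgue measure on half-open intervals, hence everywhere
    by uniqueness. *)
Lemma lebesgue_measure_affine (a b : R) (A : set R) : b != 0%R -> measurable A ->
  mu ((fun s => a + b * s)%R @^-1` A) = (`|b|^-1)%:E * mu A.
Proof.
move=> b0 mA; have nb0 : (0 < `|b|)%R by rewrite normr_gt0.
have mf := measurable_affine a b.
suff -> : mu A = mscale (`|b|%:nng)%R (pushforward mu
    (fun s : R => a + b * s : measurableTypeR R)%R) A.
- rewrite /mscale/= /pushforward.
  by rewrite muleA -EFinM mulVf ?mul1e// gt_eqF.
move=> u mf'; apply: lebesgue_measure_unique => // _ [[x y]] _ <-.
exact: lebesgue_measure_affine_itv.
Qed.

Lemma integral_reflection (c : R) (g : R -> \bar R) :
  measurable_fun [set: R] g -> (forall t, 0 <= g t) ->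
  \int[mu]_t g (c - t)%R = \int[mu]_t g t.
Proof.
move=> mg g0.
pose phi (s : R) : measurableTypeR R := (c + (-1) * s)%R.
have mphi : measurable_fun [set: R] phi by exact: measurable_affine.
have h := @ge0_integral_pushforward _ _ (measurableTypeR R) (measurableTypeR R) R
  phi mphi mu setT g measurableT mg (fun y _ => g0 y).
transitivity (\int[mu]_(x in phi @^-1` setT) (g \o phi) x).
  by rewrite preimage_setT; apply: eq_integral => t _; rewrite /phi /= mulN1r.
rewrite -h; apply: eq_measure_integral => A mA _.
have := @lebesgue_measure_affine c (-1)%R A _ mA.
by rewrite normrN1 invr1 mul1e oppr_eq0 oner_eq0 => /(_ isT).
Qed.

End AffineChange.

Section LiouvilleSections.
Context {R : realType} (Q : polygon R).
Local Notation RR := (measurableTypeR R * measurableTypeR R)%type.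
Local Notation mu := (@lebesgue_measure R).
Local Notation side := 'I_(nsides Q).
Implicit Types (A : set RR) (t : R).

Lemma measurable_snd_itv (I : interval R) :
  measurable ([set z | z.2 \in I] : set RR).
Proof.
have := @measurable_snd _ _ (measurableTypeR R) (measurableTypeR R)
  measurableT [set` I] (measurable_itv I).
by rewrite setTI.
Qed.

Lemma measurable_on_side (i : side) : measurable ([set z | on_side i z.1] : set RR).
Proof.
have := @measurable_fst _ _ (measurableTypeR R) (measurableTypeR R)
  measurableT (on_side i) (measurable_itv _).
by rewrite setTI.
Qed.

Lemma measurable_phase_space : measurable (phase_space Q : set RR).
Proof.
have -> : phase_space Q = (\bigcup_(i : side) [set z | on_side i z.1]) `&`
    [set z | z.2 \in `]0, pi[].
  apply/seteqP; split=> z.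
    by move=> [[i zi] zt]; split; [exists i|rewrite /= in_itv].
  by move=> [[i _ zi]]; rewrite /= in_itv/= => zt; split=> //; exists i.
apply: measurableI; last exact: measurable_snd_itv.
apply: fin_bigcup_measurable => // i _; exact: measurable_on_side.
Qed.

(** The density is cut off outside the range of angles, so that integrals run over the whole line
    and the change of variable [c - t] preserves their domain. *)
Definition sin_weight t : R := if 0 < t < pi then sin t else 0.

Lemma sin_weight_ge0 t : 0 <= sin_weight t.
Proof. by rewrite /sin_weight; case: ifP => // /sin_gt0_pi/ltW. Qed.

Lemma measurable_sin_snd : measurable_fun [set: RR] (fun z => (sin z.2)%:E).
Proof.
apply/measurable_EFinP; apply: measurableT_comp; last exact: measurable_snd.
by apply: continuous_measurable_fun; exact: continuous_sin.
Qed.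

Definition section_mass A t : \bar R :=
  ((sin_weight t)%:E * mu (ysection (A `&` phase_space Q) t))%E.

Lemma section_mass_ge0 A t : (0 <= section_mass A t)%E.
Proof. by rewrite mule_ge0// lee_fin sin_weight_ge0. Qed.

Lemma measurable_sin_weight : measurable_fun [set: measurableTypeR R] sin_weight.
Proof.
apply: measurable_fun_if => //.
- apply: (@measurable_fun_bool _ _ _ _ true).
  rewrite (_ : _ @^-1` _ = `]0, pi[%classic) ?setTI; first exact: measurable_itv.
  by apply/seteqP; split=> x; rewrite /= in_itv.
- apply: measurable_funTS; apply: continuous_measurable_fun; exact: continuous_sin.
Qed.

Lemma measurable_section_mass A : measurable A ->
  measurable_fun [set: measurableTypeR R] (section_mass A).
Proof.
move=> mA; apply: emeasurable_funM.
  by apply/measurable_EFinP; exact: measurable_sin_weight.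
apply: measurable_fun_ysection; apply: measurableI => //.
exact: measurable_phase_space.
Qed.

(** Tonelli with the angle as outer variable: for a fixed angle, both the billiard map between two
    sides and [lineval] are affine in the inner variable. *)
Lemma liouville_sections A : measurable A ->
  liouville Q A = (\int[mu]_t section_mass A t)%E.
Proof.
move=> mA; have mAP : measurable (A `&` phase_space Q : set RR).
  by apply: measurableI => //; exact: measurable_phase_space.
rewrite /liouville integral_mkcond fubini_tonelli2; last 2 first.
- by apply/(measurable_restrictT _ mAP)/measurable_funTS; exact: measurable_sin_snd.
- move=> z; rewrite patchE; case: ifPn => // /set_mem[_ [_ /sin_gt0_pi/ltW]].
  by rewrite lee_fin.
apply: eq_integral => t _; rewrite /fubini_G /section_mass.
have mS := measurable_ysection t mAP.
rewrite -(setIT (ysection _ t)) -integral_indic// -ge0_integralZl_EFin//; last 2 first.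
- by apply/measurable_EFinP; exact: measurable_indic.
- exact: sin_weight_ge0.
apply: eq_integral => s _; rewrite patchE indicE -EFinM.
rewrite mem_ysection.
case: ifPn => h; last by rewrite mulr0.
rewrite mulr1 /sin_weight; case: ifPn => // /negP H; exfalso; apply: H.
by move/set_mem: h => [_ []].
Qed.

End LiouvilleSections.

Section Measurability.
Context {R : realType} (Q : polygon R).
Local Notation RR := (measurableTypeR R * measurableTypeR R)%type.
Local Notation side := 'I_(nsides Q).
Local Notation plane := (R^o * R^o)%type.

Let liouville0 : liouville Q set0 = 0%E.
Proof. by rewrite /liouville set0I integral_set0. Qed.

Let liouville_pos (A : set RR) : (0 <= liouville Q A)%E.
Proof.
by rewrite /liouville integral_ge0// => z [_ [_ /sin_gt0_pi/ltW]]; rewrite lee_fin.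
Qed.

Let liouville_sigma_additive : semi_sigma_additive (liouville Q : set RR -> \bar R).
Proof.
move=> F mF tF mUF; have mP := measurable_phase_space Q.
rewrite {2}/liouville setI_bigcupl ge0_integral_bigcup//.
- apply: is_cvg_ereal_nneg_natsum_cond => n _ _; exact: liouville_pos.
- by move=> k; exact: measurableI.
- by apply: measurable_funTS; exact: measurable_sin_snd.
- by move=> z [k _ [_ [_ /sin_gt0_pi/ltW]]]; rewrite lee_fin.
- by apply: trivIset_setIr.
Qed.

HB.instance Definition _ := isMeasure.Build _ RR R (liouville Q : set RR -> \bar R)
  liouville0 liouville_pos liouville_sigma_additive.

Lemma measurable_inv : measurable_fun [set: R] (fun x : R => x^-1).
Proof.
have -> : [set: R] = [set x : R | x != 0] `|` [set 0].
  by apply/seteqP; split=> // x _; have [->|] := eqVneq x 0; [right|left].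
have o : open [set x : R | x != 0].
  have -> : [set x : R | x != 0] = ~` [set 0].
    by apply/seteqP; split=> x /= /eqP.
  by rewrite openC; exact: closed_eq.
apply/measurable_funU => //; first exact: open_measurable.
split; last exact: measurable_fun_set1.
apply: open_continuous_measurable_fun => // x; rewrite inE/= => x0.
exact: inv_continuous.
Qed.

Lemma measurable_cos_snd : measurable_fun [set: RR] (fun z => cos z.2).
Proof.
apply: measurableT_comp; last exact: measurable_snd.
by apply: continuous_measurable_fun; exact: continuous_cos.
Qed.

Lemma measurable_gt0 (f : RR -> R) : measurable_fun [set: RR] f ->
  measurable [set z | 0 < f z].
Proof.
move=> mf; have := mf measurableT _ (measurable_itv `]0, +oo[).
by rewrite setTI; congr (measurable _); apply/seteqP; split=> z; rewrite /= in_itv/= andbT.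
Qed.

Lemma measurable_neq0 (f : RR -> R) : measurable_fun [set: RR] f ->
  measurable [set z | f z != 0].
Proof.
move=> mf; have -> : [set z | f z != 0] = [set z | 0 < f z] `|` [set z | 0 < - f z].
  apply/seteqP; split=> z /=.
    by move=> /lt_total/orP[h|h]; [right; rewrite oppr_gt0|left].
  by case=> h; [rewrite gt_eqF|rewrite lt_eqF// -oppr_gt0].
by apply: measurableU; apply: measurable_gt0 => //; exact: measurable_funN.
Qed.

Lemma cross_direction (i : side) (w : plane) t : cross w (direction i t) =
  cross w (tangent i) * cos t + cross w (inner_normal i) * sin t.
Proof.
rewrite /direction; move: (tangent i) (inner_normal i) => e n.
by rewrite crossDr !crossZr [cos t * _]mulrC [sin t * _]mulrC.
Qed.

Lemma measurable_cross_direction (i : side) (w : plane) :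
  measurable_fun [set: RR] (fun z => cross w (direction i z.2)).
Proof.
have -> : (fun z : RR => cross w (direction i z.2)) = (fun z : RR =>
    cross w (tangent i) * cos z.2 + cross w (inner_normal i) * sin z.2).
  by apply/funext => z; rewrite cross_direction.
apply: measurable_funD; apply: measurable_funM => //; first exact: measurable_cos_snd.
by apply/measurable_EFinP; exact: measurable_sin_snd.
Qed.

Lemma lineval_sin (i k : side) z : lineval i z k =
  cross (vertex Q k - vertex Q i) (direction i z.2) - (z.1 - side_start i) * sin z.2.
Proof.
rewrite /lineval /foot -(cross_tangent_direction i).
move: (direction i z.2) (tangent i) (vertex Q k) (vertex Q i) => d e v w.
by rewrite /cross /= /GRing.scale /=; ring.
Qed.

Lemma measurable_lineval (i k : side) : measurable_fun [set: RR] (fun z => lineval i z k).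
Proof.
have -> : (fun z : RR => lineval i z k) = (fun z : RR =>
    cross (vertex Q k - vertex Q i) (direction i z.2) - (z.1 - side_start i) * sin z.2).
  by apply/funext => z; rewrite lineval_sin.
apply: measurable_funB; first exact: measurable_cross_direction.
apply: measurable_funM; last by apply/measurable_EFinP; exact: measurable_sin_snd.
by apply: measurable_funB => //; exact: measurable_fst.
Qed.

Lemma measurable_generic (i : side) : measurable (generic i : set RR).
Proof.
have -> : (generic i : set RR) = [set z | on_side i z.1] `&` [set z | z.2 \in `]0, pi[] `&`
    (\bigcap_(k : side) [set z | lineval i z k != 0]) `&`
    (\bigcap_(k : side) [set z : RR | cross (side_vector k) (direction i z.2) != 0]).
  apply/seteqP; split=> z.
    move=> [a b c d]; split; last by move=> k _; exact: d.
    by split; [split=> //; rewrite /= in_itv|move=> k _; exact: c].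
  by move=> [[[a b] c] d]; split=> // k; [exact: c|exact: d].
apply: measurableI; last first.
  apply: fin_bigcap_measurable => // k _; apply: measurable_neq0.
  exact: measurable_cross_direction.
apply: measurableI; last first.
  by apply: fin_bigcap_measurable => // k _; apply: measurable_neq0; exact: measurable_lineval.
by apply: measurableI; [exact: measurable_on_side|exact: measurable_snd_itv].
Qed.

(* Whether side j is hit first depends only on the sides of the line of flight
   on which the vertices lie. *)
Lemma measurable_first_hit (i j : side) : measurable (first_hit i j : set RR).
Proof.
pose signs (b : {ffun side -> bool}) : set RR :=
  generic i `&` \bigcap_(k : side) [set z | (0 < lineval i z k) = b k].
have -> : (first_hit i j : set RR) =
    \bigcup_(b in [set b | exists2 z, first_hit i j z & signs b z]) signs b.
  apply/seteqP; split=> z.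
    move=> hz; have sz : signs [ffun k => 0 < lineval i z k] z.
      by split; [case: hz|move=> k _ /=; rewrite ffunE].
    by exists [ffun k => 0 < lineval i z k] => //; exists z.
  move=> [b [w hw [_ sw]] [gz sz]]; apply: first_hit_stable hw => // k.
  by rewrite (sw k) ?(sz k).
apply: fin_bigcup_measurable => [|b _]; first exact: finite_finset.
apply: measurableI; first exact: measurable_generic.
apply: fin_bigcap_measurable => // k _.
case: (b k).
  rewrite (_ : [set z : RR | _ ] = [set z : RR | 0 < lineval i z k]).
    by apply: measurable_gt0; exact: measurable_lineval.
  by apply/seteqP; split=> z.
rewrite (_ : [set z : RR | _ ] = ~` [set z : RR | 0 < lineval i z k]).
  by apply: measurableC; apply: measurable_gt0; exact: measurable_lineval.
by apply/seteqP; split=> z /=; [move=> ->|move=> /negP/negbTE].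
Qed.

End Measurability.

Section Invariance.
Context {R : realType} (Q : polygon R).
Local Notation RR := (measurableTypeR R * measurableTypeR R)%type.
Local Notation side := 'I_(nsides Q).

Section Piece.
Context (i j : side) (c : R).
Context (angle_ij : forall z z', first_hit i j z -> step Q z z' -> z'.2 = c - z.2).

(* The billiard map from side i to side j, and its inverse, in coordinates:
   both are affine in the arc length once the angle is fixed. *)
Definition piece_map (z : RR) : RR :=
  (side_start j + (cross (vertex Q j - vertex Q i) (direction i z.2)
     - (z.1 - side_start i) * sin z.2) / sin (c - z.2), c - z.2).

Definition piece_inv (z : RR) : RR :=
  (side_start i + (cross (vertex Q j - vertex Q i) (direction i (c - z.2))
     - (z.1 - side_start j) * sin z.2) / sin (c - z.2), c - z.2).

Lemma next_piece z : first_hit i j z -> billiard_next Q z = piece_map z.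
Proof.
move=> hz; have zz := billiard_next_step (proj1 hz).
rewrite [billiard_next Q z]surjective_pairing (step_foot hz zz).
by rewrite (angle_ij hz zz).
Qed.

Lemma piece_angles z : first_hit i j z -> (0 < z.2 < pi) /\ (0 < c - z.2 < pi).
Proof.
move=> hz; have zz := billiard_next_step (proj1 hz).
rewrite -(angle_ij hz zz); split; first by case: hz => -[].
by have [_ []] := step_phase_space zz.
Qed.

Lemma piece_map_inv (s t : R) : sin t != 0 -> sin (c - t) != 0 ->
  piece_inv (piece_map (s, t)) = (s, t).
Proof.
rewrite /piece_inv /piece_map /= => a b; have e : c - (c - t) = t by ring.
rewrite e; congr pair; move: a b; move: (cross _ _) (sin t) (sin _) => W S C a b.
by field; rewrite a.
Qed.

Lemma measurable_angle_diff : measurable_fun [set: RR] (fun z => c - z.2).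
Proof. by apply: measurable_funB => //; exact: measurable_snd. Qed.

Lemma measurable_sin_diff : measurable_fun [set: RR] (fun z => sin (c - z.2)).
Proof.
apply: measurableT_comp; last exact: measurable_angle_diff.
by apply: continuous_measurable_fun; exact: continuous_sin.
Qed.

Lemma measurable_cos_diff : measurable_fun [set: RR] (fun z => cos (c - z.2)).
Proof.
apply: measurableT_comp; last exact: measurable_angle_diff.
by apply: continuous_measurable_fun; exact: continuous_cos.
Qed.

Lemma measurable_sin_snd_real : measurable_fun [set: RR] (fun z => sin z.2).
Proof. by apply/measurable_EFinP; exact: measurable_sin_snd. Qed.

Lemma measurable_piece_map : measurable_fun [set: RR] piece_map.
Proof.
apply: measurable_fun_pair; last exact: measurable_angle_diff.
apply: measurable_funD => //; apply: measurable_funM.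
  apply: measurable_funB; first exact: measurable_cross_direction.
  apply: measurable_funM; last exact: measurable_sin_snd_real.
  by apply: measurable_funB => //; exact: measurable_fst.
by apply: (measurableT_comp measurable_inv); exact: measurable_sin_diff.
Qed.

Lemma measurable_piece_inv : measurable_fun [set: RR] piece_inv.
Proof.
apply: measurable_fun_pair; last exact: measurable_angle_diff.
apply: measurable_funD => //; apply: measurable_funM.
  apply: measurable_funB.
    have -> : (fun z : RR => cross (vertex Q j - vertex Q i) (direction i (c - z.2))) =
        (fun z : RR => cross (vertex Q j - vertex Q i) (tangent i) * cos (c - z.2) +
        cross (vertex Q j - vertex Q i) (inner_normal i) * sin (c - z.2)).
      by apply/funext => z; rewrite cross_direction.
    apply: measurable_funD; apply: measurable_funM => //.
      exact: measurable_cos_diff.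
    exact: measurable_sin_diff.
  apply: measurable_funM; last exact: measurable_sin_snd_real.
  by apply: measurable_funB => //; exact: measurable_fst.
by apply: (measurableT_comp measurable_inv); exact: measurable_sin_diff.
Qed.

End Piece.

Definition piece (i j : side) (E : set RR) : set RR :=
  [set z | first_hit i j z /\ E (billiard_next Q z)].

Definition image_piece (i j : side) : set RR :=
  [set z' | exists2 z, first_hit i j z & billiard_next Q z = z'].

(** The image is written as a preimage under the explicit inverse, which makes its measurability
    immediate. *)
Lemma image_pieceE i j c :
  (forall z z' : R * R, first_hit i j z -> step Q z z' -> z'.2 = c - z.2) ->
  image_piece i j = piece_inv i j c @^-1` first_hit i j.
Proof.
move=> hc; apply/seteqP; split=> z /=.
  move=> [w hw <-]; rewrite (next_piece hc hw).
  have [/sin_gt0_pi a /sin_gt0_pi b] := piece_angles hc hw.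
  case: w hw a b => s t hw a b.
  by rewrite piece_map_inv// gt_eqF.
move=> hw; exists (piece_inv i j c z) => //.
rewrite (next_piece hc hw); have [/sin_gt0_pi + /sin_gt0_pi] := piece_angles hc hw.
case: z {hw} => s t /=; have e : c - (c - t) = t by ring.
rewrite /piece_map /piece_inv /= e; move: (cross _ _) (sin t) (sin _) => W S C a b.
by congr pair; field; rewrite !gt_eqF.
Qed.

Lemma measurable_image_piece i j : measurable (image_piece i j).
Proof.
have [c hc] := angle_sum i j; rewrite (image_pieceE hc) -[X in measurable X]setTI.
by apply: measurable_piece_inv => //; exact: measurable_first_hit.
Qed.

Lemma measurable_piece i j E : measurable E -> measurable (piece i j E).
Proof.
move=> mE; have [c hc] := angle_sum i j.
have -> : piece i j E = first_hit i j `&` piece_map i j c @^-1` E.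
  apply/seteqP; split=> z [hz Ez]; split=> //; move: Ez; rewrite /= (next_piece hc hz)//.
apply: measurableI; first exact: measurable_first_hit.
by rewrite -[X in measurable X]setTI; apply: measurable_piece_map.
Qed.

Lemma piece_phase_space i j E : piece i j E `<=` phase_space Q.
Proof. by move=> z [[gz _] _]; exact: generic_phase_space gz. Qed.

Lemma image_piece_phase_space i j : image_piece i j `<=` phase_space Q.
Proof.
by move=> z' [z hz <-]; apply: step_phase_space; exact: billiard_next_step (proj1 hz).
Qed.

(** At angle [t] the map is affine with slope of modulus [sin t / sin (c - t)], so the weight
    [sin t] turns into [sin (c - t)]. If the section at [t] is empty, the inequality is trivial. *)
Lemma section_mass_piece i j E c (t : R) : measurable E ->
  (forall z z' : R * R, first_hit i j z -> step Q z z' -> z'.2 = c - z.2) ->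
  (section_mass Q (piece i j E) t <= section_mass Q (E `&` image_piece i j) (c - t))%E.
Proof.
move=> mE hc; rewrite /section_mass.
rewrite (setIidl (@piece_phase_space i j E)).
rewrite (setIidl (subset_trans (@subIsetr _ E _) (@image_piece_phase_space i j))).
have [s0|] := pselect (exists s, piece i j E (s, t)); last first.
  move=> H; have -> : ysection (piece i j E) t = set0.
    by apply/seteqP; split=> // s; rewrite /ysection/= inE => h; apply: H; exists s.
  by rewrite measure0 mule0 mule_ge0// lee_fin sin_weight_ge0.
have [t01 ct01] : (0 < t < pi) /\ (0 < c - t < pi).
  by case: s0 => s [hs _]; exact: (piece_angles hc hs).
have S0 := sin_gt0_pi t01; have C0 := sin_gt0_pi ct01.
rewrite /sin_weight t01 ct01.
set S := sin t in S0 *; set C := sin (c - t) in C0 *.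
pose W := cross (vertex Q j - vertex Q i) (direction i t).
pose f (s : R) := side_start j + (W + side_start i * S) / C + (- (S / C)) * s.
have fE s : piece_map i j c (s, t) = (f s, c - t).
  rewrite /piece_map /= -/S -/C -/W /f; congr pair; ring.
have -> : ysection (piece i j E) t = f @^-1` ysection (E `&` image_piece i j) (c - t).
  apply/seteqP; split=> s; rewrite /ysection /= !inE -fE.
    by move=> [hs Es]; rewrite -(next_piece hc hs); split=> //; exists (s, t).
  move=> [Es]; rewrite (image_pieceE hc) /= piece_map_inv ?gt_eqF// => hs.
  by split=> //; rewrite (next_piece hc hs).
have SC : - (S / C) != 0 by rewrite oppr_eq0 mulf_neq0 ?invr_eq0 ?gt_eqF.
rewrite lebesgue_measure_affine//; last first.
  by apply: measurable_ysection; apply: measurableI => //; exact: measurable_image_piece.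
rewrite normrN gtr0_norm ?divr_gt0// muleA -EFinM.
by rewrite invf_div mulrCA mulfV ?gt_eqF// mulr1.
Qed.

Lemma liouville_piece i j E : measurable E ->
  (liouville Q (piece i j E) <= liouville Q (E `&` image_piece i j))%E.
Proof.
move=> mE; have [c hc] := angle_sum i j.
have mF : measurable (E `&` image_piece i j).
  by apply: measurableI => //; exact: measurable_image_piece.
have mP := measurable_piece i j mE.
rewrite !liouville_sections//.
rewrite -(@integral_reflection _ c (section_mass Q (E `&` image_piece i j))); last 2 first.
- exact: measurable_section_mass.
- by move=> t; exact: section_mass_ge0.
apply: ge0_le_integral => //.
- by move=> t _; exact: section_mass_ge0.
- exact: (measurable_section_mass Q mP).
- have := measurableT_comp (measurable_section_mass Q mF) (measurable_affine c (-1)).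
  by congr (measurable_fun _ _); apply/funext => t; rewrite /= mulN1r.
- by move=> t _; exact: section_mass_piece.
Qed.

(* Reversing time, the side from which a point of side j was reached is the last
   one met by its line of flight before it. *)
Lemma image_piece_inj i j i' j' z : image_piece i j z -> image_piece i' j' z ->
  i = i' /\ j = j'.
Proof.
move=> [w hw e] [w' hw' e'].
have [t [gw h0 z01 dE]] := step_first_hit hw (billiard_next_step (proj1 hw)).
have [t' [gw' h0' z01' dE']] := step_first_hit hw' (billiard_next_step (proj1 hw')).
rewrite e in h0 z01 dE; rewrite e' in h0' z01' dE'.
have [t0 js eq1 b] := h0; have [t0' js' eq1' b'] := h0'.
have jj : j = j' by exact: on_side_inj js'.
split=> //; rewrite -jj in eq1' dE'.
(* A reflection is an involution, so the incoming direction can be recovered from the outgoing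
   one. *)
have dd : direction i w.2 = direction i' w'.2.
  have refl (a : R^o * R^o) : reflect_in j (reflect_in j a) = a.
    rewrite /reflect_in; move: (inner_normal j) (dot_normal j) => n nn.
    rewrite dotBl dotZl nn mulr1 -addrA -opprD -scalerDl.
    have -> : 2 * dot a n + 2 * (dot a n - 2 * dot a n) = 0 by ring.
    by rewrite scale0r subr0.
  by rewrite -[LHS](refl _) -dE dE' refl.
have [wi wt _ _] := gw; have [wi' wt' _ _] := gw'.
have footE : foot i w.1 + t *: direction i w.2 = foot i' w'.1 + t' *: direction i w.2.
  by rewrite {2}dd -eq1 -eq1'.
have [tt|tt|tt] := ltgtP t t'.
- exfalso; apply: (b' (t' - t)); first by rewrite subr_gt0 tt ltrBlDr ltrDl.
  exists i => //; have -> : foot i' w'.1 + (t' - t) *: direction i' w'.2 = foot i w.1.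
    by rewrite -dd scalerBl addrA -footE addrK.
  exact: foot_closed_side.
- exfalso; apply: (b (t - t')); first by rewrite subr_gt0 tt ltrBlDr ltrDl.
  exists i' => //; have -> : foot i w.1 + (t - t') *: direction i w.2 = foot i' w'.1.
    by rewrite scalerBl addrA footE addrK.
  exact: foot_closed_side.
- move: footE; rewrite tt => /addIr f.
  by have [] := foot_inj wi wi' f.
Qed.

(** A union of pieces, and not a plain preimage under [billiard_next]: the default value at points
    without successor must not be counted. *)
Definition preimage_next (E : set RR) : set RR :=
  \bigcup_(ij : side * side) piece ij.1 ij.2 E.

Lemma measurable_preimage_next E : measurable E -> measurable (preimage_next E).
Proof.
move=> mE; apply: fin_bigcup_measurable => [|ij _]; first exact: finite_finset.
exact: measurable_piece.
Qed.

(** The pieces are summed by subadditivity. Their images are pairwise disjoint, so the traces of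
    these images on [E] have total measure at most that of [E]. *)
Lemma liouville_preimage_next E : measurable E ->
  (liouville Q (preimage_next E) <= liouville Q E)%E.
Proof.
move=> mE; have mF (ij : side * side) : measurable (E `&` image_piece ij.1 ij.2).
  by apply: measurableI => //; exact: measurable_image_piece.
have fin : finite_set [set: side * side] by exact: finite_finset.
apply: (@le_trans _ _ (\sum_(ij \in [set: side * side]) liouville Q (piece ij.1 ij.2 E))%E).
  apply: content_sub_fsum => //; last exact: measurable_preimage_next.
  by move=> ij _; exact: measurable_piece.
apply: (@le_trans _ _ (\sum_(ij \in [set: side * side])
    liouville Q (E `&` image_piece ij.1 ij.2))%E).
  by apply: lee_fsum => // ij _; exact: liouville_piece.
rewrite -measure_fin_bigcup//; last first.
  move=> [i j] [i' j'] _ _ [z [[_ h] [_ h']]].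
  by have [/= -> ->] := image_piece_inj h h'.
apply: le_measure; rewrite ?inE//.
  by apply: fin_bigcup_measurable.
by move=> z [ij _ []].
Qed.

End Invariance.

(** * Trajectories staying away from the vertices *)

Lemma fsum_finType {R : realType} (T : finType) (f : T -> \bar R) :
  (\sum_(i \in [set: T]) f i = \sum_i f i)%E.
Proof.
have -> : [set: T] = [set` enum T].
  by apply/seteqP; split=> x //= _; rewrite mem_enum.
by rewrite -fsbig_seq ?enum_uniq// big_enum.
Qed.

Section NearVertices.
Context {R : realType} (Q : polygon R).
Local Notation RR := (measurableTypeR R * measurableTypeR R)%type.
Local Notation mu := (@lebesgue_measure R).
Local Notation side := 'I_(nsides Q).
Local Notation n := (nsides Q).

Lemma liouville_bound (A : set RR) (m : \bar R) : measurable A -> (0 <= m)%E ->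
  (forall t, 0 < t < pi -> (section_mass Q A t <= m)%E) ->
  (liouville Q A <= m * pi%:E)%E.
Proof.
move=> mA m0 H; rewrite liouville_sections//.
have -> : (m * pi%:E = \int[mu]_t ((cst m) \_ `]0%R, pi[) t)%E.
  rewrite -integral_mkcond integral_cst//=; congr (_ * _)%E.
  by rewrite lebesgue_measure_itv/= lte_fin pi_gt0 oppr0 adde0.
apply: ge0_le_integral => //.
- by move=> t _; exact: section_mass_ge0.
- exact: (measurable_section_mass Q mA).
- by apply: (measurable_restrictT (cst m) (measurable_itv `]0, pi[)).1; exact: measurable_cst.
- move=> t _; rewrite patchE mem_setE in_itv/=; case: ifPn => [/H//|t01].
  by rewrite /section_mass /sin_weight (negbTE t01) mul0e.
Qed.

Definition strip (i k : side) (B : set R) : set RR :=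
  [set z | [/\ on_side i z.1, 0 < z.2 < pi & B (lineval i z k)]].

Lemma strip_phase_space i k B : strip i k B `<=` phase_space Q.
Proof. by move=> z [zi zt _]; split=> //; exists i. Qed.

Lemma measurable_strip i k (B : set R) : measurable (B : set (measurableTypeR R)) ->
  measurable (strip i k B).
Proof.
move=> mB; have -> : strip i k B = [set z | on_side i z.1] `&`
    [set z | z.2 \in `]0, pi[] `&` (fun z => lineval i z k) @^-1` B.
  by apply/seteqP; split=> z [] => [a b c|[a b] c].
apply: measurableI.
  by apply: measurableI; [exact: measurable_on_side|exact: measurable_snd_itv].
by rewrite -[X in measurable X]setTI; exact: measurable_lineval.
Qed.

Lemma liouville_strip i k (B : set R) : measurable (B : set (measurableTypeR R)) ->
  (liouville Q (strip i k B) <= mu B * pi%:E)%E.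
Proof.
move=> mB; have mS := measurable_strip i k mB.
apply: liouville_bound => // t t01; have S0 := sin_gt0_pi t01.
rewrite /section_mass (setIidl (@strip_phase_space i k B)) /sin_weight t01.
set S := sin t in S0 *.
pose W := cross (vertex Q k - vertex Q i) (direction i t).
pose f (s : R) := W + side_start i * S + (- S) * s.
have mf : measurable (f @^-1` B).
  by rewrite -[X in measurable X]setTI; exact: measurable_affine.
apply: (@le_trans _ _ (S%:E * mu (f @^-1` B))%E).
  apply: lee_wpmul2l; first by rewrite lee_fin ltW.
  apply: le_measure; rewrite ?inE//; first exact: measurable_ysection.
  move=> s; rewrite /ysection/= inE => -[_ _]; rewrite lineval_sin /= -/W -/S /f.
  by congr (B _); ring.
rewrite lebesgue_measure_affine ?oppr_eq0 ?gt_eqF// normrN gtr0_norm//.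
by rewrite muleA -EFinM mulfV ?mul1e// gt_eqF.
Qed.

Definition parallel (i k : side) : set RR :=
  [set z | [/\ on_side i z.1, 0 < z.2 < pi & cross (side_vector k) (direction i z.2) = 0]].

Lemma measurable_parallel i k : measurable (parallel i k).
Proof.
have -> : parallel i k = [set z | on_side i z.1] `&` [set z | z.2 \in `]0, pi[] `&`
    ~` [set z : RR | cross (side_vector k) (direction i z.2) != 0].
  apply/seteqP; split=> z [].
    by move=> a b c; split=> //; rewrite /= c eqxx.
  by move=> [a b] /= /negP; rewrite negbK => /eqP c.
apply: measurableI.
  by apply: measurableI; [exact: measurable_on_side|exact: measurable_snd_itv].
by apply: measurableC; apply: measurable_neq0; exact: measurable_cross_direction.
Qed.

(** Two such angles give a homogeneous linear system for the components of the side vector, with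
    determinant [sin (b - a)]. It is nonzero for distinct angles, whereas a side vector does not
    vanish. *)
Lemma parallel_angle_unique (i k : side) (t t' : R) : 0 < t < pi -> 0 < t' < pi ->
  cross (side_vector k) (direction i t) = 0 ->
  cross (side_vector k) (direction i t') = 0 -> t = t'.
Proof.
suff H (a b : R) : 0 < a < pi -> 0 < b < pi -> cross (side_vector k) (direction i a) = 0 ->
    cross (side_vector k) (direction i b) = 0 -> a < b -> False.
  move=> t0 t'0 c c'; apply/eqP/negPn/negP => /lt_total/orP[h|h].
    exact: (H t t').
  exact: (H t' t).
move=> /andP[a0 a1] /andP[b0 b1]; rewrite !cross_direction.
have := side_vector_neq0 k; have := cross_tangent_normal i; have := dot_tangent i.
rewrite /inner_normal; move: (side_vector k) (tangent i) => e f ff _ ee.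
set x := cross e f; set y := cross e (rot90 f) => ea eb ab.
have s0 : 0 < sin (b - a) by apply: sin_gt0_pi; apply/andP; split; lra.
have : x * sin (b - a) = 0.
  transitivity (sin b * (x * cos a + y * sin a) - sin a * (x * cos b + y * sin b)).
    by rewrite sinB; ring.
  by rewrite ea eb; ring.
have : y * sin (b - a) = 0.
  transitivity (cos a * (x * cos b + y * sin b) - cos b * (x * cos a + y * sin a)).
    by rewrite sinB; ring.
  by rewrite ea eb; ring.
move=> /eqP; rewrite mulf_eq0 (gt_eqF s0) orbF => /eqP y0.
move=> /eqP; rewrite mulf_eq0 (gt_eqF s0) orbF => /eqP x0.
move: ee; have -> : dot e e = x ^+ 2 + y ^+ 2; last by rewrite x0 y0 expr0n/= addr0 eqxx.
by rewrite -[LHS]mulr1 -ff /x /y /dot /cross /rot90 /=; ring.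
Qed.

Lemma liouville_parallel i k : liouville Q (parallel i k) = 0%E.
Proof.
rewrite liouville_sections; last exact: measurable_parallel.
have [t0 H] : exists t0, forall z, parallel i k z -> z.2 = t0.
  have [[z0 h0]|h] := pselect (exists z0, parallel i k z0).
    exists z0.2 => z [_ zt zc]; have [_ z0t z0c] := h0.
    exact: parallel_angle_unique zt z0t zc z0c.
  by exists 0 => z hz; exfalso; apply: h; exists z.
transitivity (\int[mu]_t (section_mass Q (parallel i k) \_ [set t0]) t)%E.
  apply: eq_integral => t _; rewrite patchE; case: ifPn => // /negP tt0.
  rewrite /section_mass; set Y := ysection _ _.
  have -> : Y = set0; last by rewrite measure0 mule0.
  apply/seteqP; split=> // s; rewrite /Y /ysection/= inE => -[/H h _].
  by apply: tt0; rewrite inE.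
by rewrite -integral_mkcond integral_set1.
Qed.

Definition singular : set RR := [set z | phase_space Q z /\ forall i : side, ~ generic i z].

Definition near_vertex (d : R) : set RR :=
  \bigcup_(ik : side * side) strip ik.1 ik.2 `]- d, d[.

Lemma measurable_near_vertex d : measurable (near_vertex d).
Proof.
apply: fin_bigcup_measurable => [|ik _]; first exact: finite_finset.
by apply: measurable_strip; exact: measurable_itv.
Qed.

Lemma measurable_singular : measurable singular.
Proof.
have -> : singular = phase_space Q `\` \bigcup_(i : side) (generic i).
  apply/seteqP; split=> z [zp H]; split=> //; first by move=> [i _ /H].
  by move=> i gi; apply: H; exists i.
apply: measurableD; first exact: measurable_phase_space.
apply: fin_bigcup_measurable => [|i _]; first exact: finite_finset.
exact: measurable_generic.
Qed.

(** The constant counts the pairs of a starting side and a vertex; each strip has width [2 * d], and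
    [pi] is the length of the range of angles. *)
Lemma liouville_near_vertex d : 0 < d ->
  (liouville Q (near_vertex d) <= (n%:R ^+ 2 * (2 * d * pi))%:E)%E.
Proof.
move=> d0; have fin : finite_set [set: side * side] by exact: finite_finset.
apply: (@le_trans _ _ (\sum_(ik \in [set: side * side]) (2 * d * pi)%:E)%E); last first.
  rewrite fsum_finType sumEFin lee_fin sumr_const card_prod card_ord.
  by rewrite -[leLHS]mulr_natl natrM expr2.
pose F (ik : side * side) : set RR := strip ik.1 ik.2 `]- d, d[%classic.
apply: (@le_trans _ _ (\sum_(ik \in [set: side * side]) liouville Q (F ik))%E).
  apply: content_sub_fsum => //; last exact: measurable_near_vertex.
  by move=> ik _; apply: measurable_strip; exact: measurable_itv.
apply: lee_fsum => // ik _.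
have := @liouville_strip ik.1 ik.2 `]- d, d[%classic (measurable_itv _).
rewrite lebesgue_measure_itv/= lte_fin; have -> : - d < d by lra.
by rewrite -EFinB -EFinM opprK (_ : d + d = 2 * d)//; ring.
Qed.

Lemma liouville_singular : liouville Q singular = 0%E.
Proof.
apply/eqP; rewrite eq_le measure_ge0 andbT.
have fin : finite_set [set: side * side] by exact: finite_finset.
pose F (ik : side * side) : set RR := strip ik.1 ik.2 [set 0] `|` parallel ik.1 ik.2.
have m0 : measurable ([set 0] : set (measurableTypeR R)) by exact: measurable_set1.
have mF ik : measurable (F ik).
  by apply: measurableU; [exact: measurable_strip|exact: measurable_parallel].
apply: (@le_trans _ _ (\sum_(ik \in [set: side * side]) liouville Q (F ik))%E).
  apply: content_sub_fsum => //; first exact: measurable_singular.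
  move=> z [[[i zi] zt] H].
  have := H i; rewrite /generic => h; apply: contrapT => G.
  apply: h; split=> // k; apply/eqP => e; apply: G; exists (i, k) => //; [left|right];
    by split.
rewrite fsbig1// => ik _; apply/eqP; rewrite eq_le measure_ge0 andbT.
apply: (@le_trans _ _ (liouville Q (strip ik.1 ik.2 [set 0%R]) +
    liouville Q (parallel ik.1 ik.2))%E).
  by apply: measureU2; [exact: measurable_strip|exact: measurable_parallel].
rewrite liouville_parallel adde0.
by apply: (le_trans (liouville_strip _ _ m0)); rewrite lebesgue_measure_set1 mul0e.
Qed.

Definition perimeter : R := \sum_(i < n) side_length i.

Lemma on_side_perimeter (i : side) (s : R) : on_side i s -> 0 < s < perimeter.
Proof.
rewrite /on_side/= in_itv/= => /andP[a b]; apply/andP; split.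
  by apply: le_lt_trans a; apply: sumr_ge0 => k _; rewrite ltW// side_length_gt0.
apply: (lt_le_trans b); rewrite /perimeter (bigID (fun k : side => (k < i)%N))/=.
rewrite lerD2l (bigD1 i)/= ?ltnn// lerDl sumr_ge0// => k _.
by rewrite ltW// side_length_gt0.
Qed.

Lemma perimeter_gt0 : 0 < perimeter.
Proof.
have n0 : (0 < n)%N by exact: ltn_trans (nsides_ge3 Q).
rewrite /perimeter (bigD1 (Ordinal n0))//= ltr_pwDl ?side_length_gt0//.
by apply: sumr_ge0 => k _; rewrite ltW// side_length_gt0.
Qed.

Lemma liouville_phase_space_lty : (liouville Q (phase_space Q) < +oo)%E.
Proof.
apply: (@le_lt_trans _ _ (perimeter%:E * pi%:E)%E); last by rewrite -EFinM ltry.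
have mP := measurable_phase_space Q.
apply: liouville_bound => //; first by rewrite lee_fin ltW// perimeter_gt0.
move=> t t01; rewrite /section_mass setIid /sin_weight t01.
rewrite -[leRHS]mul1e; apply: lee_pmul => //.
- by rewrite lee_fin ltW// sin_gt0_pi.
- by rewrite lee_fin sin_le1.
apply: (@le_trans _ _ (mu `]0, perimeter[%classic)).
  apply: le_measure; rewrite ?inE//; first exact: measurable_ysection.
  by move=> s; rewrite /ysection/= inE => -[[i /on_side_perimeter h] _]; rewrite in_itv.
by rewrite lebesgue_measure_itv/= lte_fin perimeter_gt0 oppr0 adde0.
Qed.

Lemma liouville_phase_space_gt0 : (0 < liouville Q (phase_space Q))%E.
Proof.
have n0 : (0 < n)%N by exact: ltn_trans (nsides_ge3 Q).
pose i : side := Ordinal n0; have l0 := side_length_gt0 i.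
have p0 : 0 < pi :> R := pi_gt0 R.
(* A compact range of angles, of length [pi / 4], on which the sine has a positive minimum; a single
   side is enough for positivity. *)
have [||c] := @EVT_min R sin (pi / 4) (pi / 2).
- by lra.
- by apply: continuous_subspaceT; exact: continuous_sin.
rewrite in_itv/= => /andP[c1 c2] cmin.
have sc : 0 < sin c by apply: sin_gt0_pi; apply/andP; split; lra.
apply: (@lt_le_trans _ _ ((sin c * side_length i)%:E * (pi / 4)%:E)%E).
  by rewrite -EFinM lte_fin; apply: mulr_gt0; [exact: mulr_gt0|lra].
have mP := measurable_phase_space Q.
rewrite liouville_sections//.
have -> : ((sin c * side_length i)%:E * (pi / 4)%:E =
   \int[mu]_t ((cst (sin c * side_length i)%:E) \_ `[(pi / 4)%R, (pi / 2)%R]) t)%E.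
  rewrite -integral_mkcond integral_cst//=; congr (_ * _)%E.
  rewrite lebesgue_measure_itv/= lte_fin ifT; last by lra.
  by rewrite -EFinB; congr (_%:E); lra.
apply: ge0_le_integral => //.
- by move=> t _; rewrite patchE; case: ifP => // _; rewrite lee_fin ltW// mulr_gt0.
- apply: (measurable_restrictT (cst (sin c * side_length i)%:E)
    (measurable_itv `[pi / 4, pi / 2])).1; exact: measurable_cst.
- exact: (measurable_section_mass Q mP).
move=> t _; rewrite patchE mem_setE; case: ifPn => [t1|_]; last exact: section_mass_ge0.
have := cmin t t1; move: t1; rewrite in_itv/= => /andP[t1 t2] ct.
have t01 : 0 < t < pi by apply/andP; split; lra.
rewrite /section_mass setIid /sin_weight t01 EFinM; apply: lee_pmul => //.
- by rewrite lee_fin ltW.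
- by rewrite lee_fin ltW.
apply: (@le_trans _ _ (mu (on_side i))).
  rewrite /on_side lebesgue_measure_itv/= lte_fin ltrDl l0 -EFinB lee_fin.
  by rewrite addrC addKr.
apply: le_measure; rewrite ?inE//; [exact: measurable_itv|exact: measurable_ysection|].
by move=> s si; rewrite /ysection/= inE; split=> //; exists i.
Qed.

End NearVertices.

(** * Orbits that stay generic and far from the vertices *)

Section GoodPoints.
Context {R : realType} (Q : polygon R).
Local Notation RR := (measurableTypeR R * measurableTypeR R)%type.
Local Notation side := 'I_(nsides Q).

Definition billiard_orbit (z : RR) (k : nat) : RR := iter k (billiard_next Q) z.

Lemma orbitSr z k : billiard_orbit (billiard_next Q z) k = billiard_orbit z k.+1.
Proof. by rewrite /billiard_orbit iterSr. Qed.

(** Genericity before time [k] lets the membership at time [k] be pulled back, as [preimage_next]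
    contains only points with a genuine successor. *)
Lemma iter_preimage_next z k (E : set RR) :
  (forall l, (l < k)%N -> exists i : side, generic i (billiard_orbit z l)) ->
  E (billiard_orbit z k) ->
  iter k (@preimage_next R Q) E z.
Proof.
elim: k z => [//|k IH] z gz Ez; rewrite iterS.
have [i gi] := gz 0%N isT; have [j hij] := first_hit_exists gi.
exists (i, j) => //; split=> //; apply: IH; last by rewrite orbitSr.
by move=> l lk; rewrite orbitSr; exact: gz.
Qed.

Lemma measurable_iter_preimage_next k (E : set RR) : measurable E ->
  measurable (iter k (@preimage_next R Q) E).
Proof. by move=> mE; elim: k => // k IH; rewrite iterS; exact: measurable_preimage_next. Qed.

Lemma liouville_iter_preimage_next k (E : set RR) : measurable E ->
  (liouville Q (iter k (@preimage_next R Q) E) <= liouville Q E)%E.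
Proof.
move=> mE; elim: k => // k IH; rewrite iterS; apply: le_trans IH.
by apply: liouville_preimage_next; exact: measurable_iter_preimage_next.
Qed.

(** Singular points are excluded at all times, at no cost in measure, so that infinite codes exist.
    Nearness to a vertex is excluded only before time [m], as each time costs measure. *)
Definition bad (d : R) (m : nat) : set RR :=
  (\bigcup_k iter k (@preimage_next R Q) (singular Q)) `|`
  (\big[setU/set0]_(k < m) iter k (@preimage_next R Q) (near_vertex Q d)).

Definition good (d : R) (m : nat) : set RR := phase_space Q `\` bad d m.

Lemma measurable_bad d m : measurable (bad d m).
Proof.
apply: measurableU.
  apply: bigcupT_measurable => k; apply: measurable_iter_preimage_next.
  exact: measurable_singular.
apply: bigsetU_measurable => k _; apply: measurable_iter_preimage_next.
exact: measurable_near_vertex.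
Qed.

Lemma measurable_good d m : measurable (good d m).
Proof. by apply: measurableD; [exact: measurable_phase_space|exact: measurable_bad]. Qed.

Lemma liouville_bad d m : 0 < d ->
  (liouville Q (bad d m) <= (m%:R * ((nsides Q)%:R ^+ 2 * (2 * d * pi)))%:E)%E.
Proof.
move=> d0; rewrite /bad; set A := \bigcup_k _; set B := \big[setU/set0]_(k < m) _.
have mA : measurable A.
  apply: bigcupT_measurable => k; apply: measurable_iter_preimage_next.
  exact: measurable_singular.
have mN k : measurable (iter k (@preimage_next R Q) (near_vertex Q d)).
  by apply: measurable_iter_preimage_next; exact: measurable_near_vertex.
have mB : measurable B by apply: bigsetU_measurable => k _; exact: mN.
have A0 : (liouville Q A <= 0)%E.
  have mS k : measurable (iter k (@preimage_next R Q) (singular Q)).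
    by apply: measurable_iter_preimage_next; exact: measurable_singular.
  apply: le_trans (measure_sigma_subadditive _ mS mA (@subset_refl _ A)) _.
  rewrite eseries0// => k _ _; apply/eqP; rewrite eq_le measure_ge0 andbT.
  apply: (le_trans (liouville_iter_preimage_next _ _)); first exact: measurable_singular.
  by rewrite liouville_singular.
apply: (le_trans (measureU2 _ mA mB)).
rewrite -[leRHS]add0e; apply: leeD => //.
apply: (@le_trans _ _ (\sum_(k < m)
    liouville Q (iter k (@preimage_next R Q) (near_vertex Q d)))%E).
  apply: (@content_subadditive _ _ _ (liouville Q) B
    (fun k => iter k (@preimage_next R Q) (near_vertex Q d)) m) => //.
apply: (@le_trans _ _ (\sum_(k < m) ((nsides Q)%:R ^+ 2 * (2 * d * pi))%:E)%E).
  apply: lee_sum => k _.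
  apply: (le_trans (liouville_iter_preimage_next _ (measurable_near_vertex Q d))).
  exact: liouville_near_vertex.
by rewrite sumEFin lee_fin sumr_const card_ord [leRHS]mulr_natl.
Qed.

Lemma liouville_good d m : 0 < d ->
  (liouville Q (phase_space Q) <=
   liouville Q (good d m) + (m%:R * ((nsides Q)%:R ^+ 2 * (2 * d * pi)))%:E)%E.
Proof.
move=> d0; have mP := measurable_phase_space Q.
have mG := measurable_good d m; have mB := measurable_bad d m.
apply: (@le_trans _ _ (liouville Q (good d m `|` bad d m))).
  apply: le_measure; rewrite ?inE//; first exact: measurableU.
  by move=> z zp; have [|] := pselect (bad d m z); [right|left].
apply: (le_trans (measureU2 _ mG mB)); apply: leeD => //; exact: liouville_bad.
Qed.

Section Orbit.
Context (d : R) (m : nat) (z : RR) (zg : good d m z).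

(** Strong induction: pulling a singular point back from time [k] to time 0 requires genericity at
    all earlier times. *)
Lemma good_generic k : exists i : side, generic i (billiard_orbit z k).
Proof.
have [zp zb] := zg.
elim/ltn_ind: k => k IH; apply: contrapT => H; apply: zb; left; exists k => //.
apply: iter_preimage_next => //; split; last by move=> i gi; apply: H; exists i.
case: k IH {H} => [//|k] IH; have [i gi] := IH k (ltnSn k).
by apply: step_phase_space; exact: billiard_next_step gi.
Qed.

Lemma good_far (i v : side) k : (k < m)%N -> generic i (billiard_orbit z k) ->
  d <= `|lineval i (billiard_orbit z k) v|.
Proof.
move=> km gi; have [zp zb] := zg; rewrite leNgt; apply/negP => H; apply: zb; right.
rewrite -bigcup_mkord; exists k => //.
apply: iter_preimage_next; first by move=> l _; exact: good_generic.
exists (i, v) => //; have [zi zt _ _] := gi; split=> //.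
by rewrite /= in_itv/= -ltr_norml.
Qed.

Lemma good_code : exists x : nat -> side, forall k, generic (x k) (billiard_orbit z k).
Proof. by have [x hx] := choice good_generic; exists x. Qed.

End Orbit.

Lemma is_code_orbit z (x : nat -> side) : (forall k, generic (x k) (billiard_orbit z k)) ->
  is_code z x.
Proof.
move=> gx; exists (billiard_orbit z); split=> // k; last by have [] := gx k.
by apply: step_billiard; exact: billiard_next_step (gx k).
Qed.

End GoodPoints.

(** * Nearby trajectories and the number of words *)

Section Lipschitz.
Context {R : realType}.
Implicit Types (x y : R).

Lemma lipschitz_of_derive (f df : R -> R) : (forall x, is_derive x 1 f (df x)) ->
  (forall x, `|df x| <= 1) -> forall x y, `|f x - f y| <= `|x - y|.
Proof.
move=> fd df1; suff H x y : x <= y -> `|f x - f y| <= `|x - y|.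
  move=> x y; have [|/ltW] := leP x y; first exact: H.
  by move=> /H; rewrite -normrN opprB -[X in _ <= X]normrN opprB.
move=> xy; have [|c _ e] := @MVT_segment _ f df x y xy (fun z _ => fd z).
  by apply: derivable_within_continuous => z _; case: (fd z).
have -> : f x - f y = df c * (x - y) by rewrite -[LHS]opprB e; ring.
by rewrite normrM ler_piMl.
Qed.

Lemma sin_lipschitz x y : `|sin x - sin y| <= `|x - y|.
Proof.
apply: (@lipschitz_of_derive _ cos) => z.
by rewrite ler_norml cos_geN1 cos_le1.
Qed.

Lemma cos_lipschitz x y : `|cos x - cos y| <= `|x - y|.
Proof.
apply: (@lipschitz_of_derive _ (fun z => - sin z)) => z.
by rewrite normrN ler_norml sin_geN1 sin_le1.
Qed.

End Lipschitz.

Section Closeness.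
Context {R : realType} (Q : polygon R).
Local Notation side := 'I_(nsides Q).
Local Notation plane := (R^o * R^o)%type.
Implicit Types (i j k : side) (z w : R * R).

Lemma norm_le_of_sqr (x a : R) : 0 <= a -> x ^+ 2 <= a ^+ 2 -> `|x| <= a.
Proof.
move=> a0 h; rewrite -(@ler_pXn2r _ 2) ?nnegrE//.
by rewrite -normrX ger0_norm ?sqr_ge0.
Qed.

Lemma cross_bound (x y : plane) (a b : R) : 0 <= a -> 0 <= b ->
  dot x x <= a ^+ 2 -> dot y y <= b ^+ 2 -> `|cross x y| <= a * b.
Proof.
move=> a0 b0 xa yb; apply: norm_le_of_sqr; first exact: mulr_ge0.
apply: (@le_trans _ _ (dot x x * dot y y)).
  have -> : dot x x * dot y y = cross x y ^+ 2 + dot x y ^+ 2.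
    by rewrite /cross /dot; ring.
  by rewrite lerDl sqr_ge0.
by rewrite exprMn; apply: ler_pM => //; rewrite /dot addr_ge0// -expr2 sqr_ge0.
Qed.

Lemma dot_bound (x y : plane) (a b : R) : 0 <= a -> 0 <= b ->
  dot x x <= a ^+ 2 -> dot y y <= b ^+ 2 -> `|dot x y| <= a * b.
Proof.
move=> a0 b0 xa yb; rewrite -cross_rot90r.
apply: (cross_bound a0 b0 xa) => //.
by rewrite dot_rot90_rot90.
Qed.

(* The pair (direction, offset) determines the line of flight, and reflection in
   a side acts linearly on it; this keeps the divergence of trajectories linear
   in time. *)
Definition offset i z : R := cross (foot i z.1) (direction i z.2).

Lemma reflectB j (x y : plane) : reflect_in j x - reflect_in j y = reflect_in j (x - y).
Proof.
rewrite /reflect_in; move: (inner_normal j) => n.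
by apply/pair_equal_spec; split; rewrite /dot /= /GRing.scale /=; ring.
Qed.

(** The offset is constant along the line, so it can be evaluated at the new foot point, whose
    normal component is that of the vertex [j]. *)
Lemma step_offset i j z z' : first_hit i j z -> step Q z z' ->
  offset j z' = - offset i z +
    2 * dot (vertex Q j) (inner_normal j) * cross (inner_normal j) (direction i z.2).
Proof.
move=> hz /(step_first_hit hz)[t [gz [_ _ e _] _ de]].
rewrite /offset de; set d := direction i z.2 in e *; set n := inner_normal j.
have -> : cross (foot i z.1) d = cross (foot j z'.1) d.
  by rewrite e crossDl crossZl crossvv mulr0 addr0.
have -> : dot (vertex Q j) n = dot (foot j z'.1) n.
  rewrite /foot dotDl dotZl /n dot_tangent_normal mulr0 addr0//.
move: (dot_normal j) (foot j z'.1); rewrite /reflect_in -/n => nn x.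
rewrite crossBr crossZr.
have : cross x d = dot d n * cross x n + dot x n * cross n d; last by lra.
by rewrite -[LHS]mulr1 -nn /cross /dot; ring.
Qed.

Section Bounds.
Context (C : R) (C0 : 0 <= C) (hC : forall k, dot (vertex Q k) (vertex Q k) <= C ^+ 2).

Definition close i (b q : R) z w : Prop :=
  let u := direction i z.2 - direction i w.2 in
  dot u u <= b ^+ 2 /\ `|offset i z - offset i w| <= q.

(** Reflection is an isometry, so the bound [b] on directions does not grow; only the offset
    deteriorates, by a fixed amount per hit. *)
Lemma close_step i j b q z w z' w' : 0 <= b -> first_hit i j z -> first_hit i j w ->
  step Q z z' -> step Q w w' -> close i b q z w -> close j b (q + 2 * C * b) z' w'.
Proof.
move=> b0 hz hw zz' ww' [ub qb].
have [_ [_ _ _ dz]] := step_first_hit hz zz'.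
have [_ [_ _ _ dw]] := step_first_hit hw ww'.
rewrite /close /= dz dw reflectB reflect_dot (step_offset hz zz') (step_offset hw ww').
split=> //; set n := inner_normal j; set v := vertex Q j.
have n1 : dot n n <= 1 ^+ 2 by rewrite expr1n /n dot_normal.
rewrite (_ : _ - _ = - (offset i z - offset i w) +
    2 * dot v n * cross n (direction i z.2 - direction i w.2)); last first.
  by rewrite crossBr; ring.
apply: (le_trans (ler_normD _ _)); rewrite normrN; apply: lerD => //.
have c1 := cross_bound ler01 b0 n1 ub; rewrite mul1r in c1.
have c2 := dot_bound C0 ler01 (hC j) n1; rewrite mulr1 in c2.
by rewrite !normrM ger0_norm// -!mulrA ler_pM2l// ler_pM.
Qed.

Lemma close_lineval i b q z w k : 0 <= b -> close i b q z w ->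
  `|lineval i z k - lineval i w k| <= C * b + q.
Proof.
move=> b0 [ub qb]; rewrite !lineval_level -/(offset i z) -/(offset i w).
rewrite (_ : _ - _ = cross (vertex Q k) (direction i z.2 - direction i w.2) -
    (offset i z - offset i w)); last by rewrite crossBr; ring.
by apply: (le_trans (ler_normB _ _)); apply: lerD => //; exact: cross_bound.
Qed.

Lemma foot_bound i (s : R) : on_side i s -> dot (foot i s) (foot i s) <= C ^+ 2.
Proof.
move=> /on_side_ratio; rewrite foot_vector; set r := (_ / _) => /andP[r0 r1].
have v1 := hC i; have v2 := hC (ordS i).
have /ler_normlW v3 := dot_bound C0 C0 v1 v2.
have -> : vertex Q i + r *: side_vector i = (1 - r) *: vertex Q i + r *: vertex Q (ordS i).
  rewrite vertexS; move: (vertex Q i) (side_vector i) => x e.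
  by apply/pair_equal_spec; split; rewrite /= /GRing.scale /=; ring.
move: (vertex Q i) (vertex Q (ordS i)) v1 v2 v3 => x y v1 v2 v3.
rewrite !(dotDl, dotDr, dotZl, dotZr) [dot y x]dotC.
have r1' : 0 <= 1 - r by lra.
have h1 : (1 - r) * ((1 - r) * dot x x) <= (1 - r) * ((1 - r) * C ^+ 2).
  by rewrite !ler_wpM2l.
have h2 : r * (r * dot y y) <= r * (r * C ^+ 2) by rewrite !ler_wpM2l// ltW.
have h3 : r * ((1 - r) * dot x y) <= r * ((1 - r) * (C * C)).
  by rewrite !ler_wpM2l// ltW.
have : C ^+ 2 = (1 - r) * ((1 - r) * C ^+ 2) + r * (r * C ^+ 2) + 2 * (r * ((1 - r) * (C * C))).
  by ring.
have -> : (1 - r) * (r * dot x y) = r * ((1 - r) * dot x y) by ring.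
by lra.
Qed.

(** The two components of the direction vary by at most [eta] each, and [2 * eta] rounds up the
    resulting norm. In the offset, [eta] is due to the displacement of the foot point and
    [2 * C * eta] to the change of direction. *)
Lemma close_init i (eta : R) z w : on_side i z.1 -> on_side i w.1 ->
  `|z.1 - w.1| <= eta -> `|z.2 - w.2| <= eta ->
  close i (2 * eta) (eta + 2 * C * eta) z w.
Proof.
move=> zi wi h1 h2; have e0 : 0 <= eta by exact: le_trans h1.
have ub : dot (direction i z.2 - direction i w.2) (direction i z.2 - direction i w.2)
    <= (2 * eta) ^+ 2.
  have -> : direction i z.2 - direction i w.2 =
      (cos z.2 - cos w.2) *: tangent i + (sin z.2 - sin w.2) *: inner_normal i.
    rewrite /direction; move: (tangent i) (inner_normal i) => e n.
    by apply/pair_equal_spec; split; rewrite /= /GRing.scale /=; ring.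
  have := dot_tangent_normal i; have := dot_normal i; have := dot_tangent i.
  move: (tangent i) (inner_normal i) => e n ee nn en.
  rewrite !(dotDl, dotDr, dotZl, dotZr) [dot n e]dotC ee nn en !mulr0 addr0 add0r !mulr1.
  have sq (x : R) : `|x| <= eta -> x * x <= eta ^+ 2.
    move=> hx; rewrite -expr2 -(ger0_norm (sqr_ge0 x)) normrX.
    by apply: lerXn2r; rewrite ?nnegrE.
  have := sq _ (le_trans (cos_lipschitz z.2 w.2) h2).
  have := sq _ (le_trans (sin_lipschitz z.2 w.2) h2).
  have : 0 <= eta ^+ 2 by exact: sqr_ge0.
  by rewrite exprMn; lra.
split=> //; rewrite /offset.
rewrite (_ : _ - _ = cross (foot i z.1 - foot i w.1) (direction i z.2) +
   cross (foot i w.1) (direction i z.2 - direction i w.2)); last first.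
  by rewrite crossBr crossBl; ring.
apply: (le_trans (ler_normD _ _)); apply: lerD.
  have -> : foot i z.1 - foot i w.1 = (z.1 - w.1) *: tangent i.
    rewrite /foot; move: (tangent i) => e.
    by apply/pair_equal_spec; split; rewrite /= /GRing.scale /=; ring.
  rewrite crossZl cross_tangent_direction normrM -[leRHS]mulr1; apply: ler_pM => //.
  by rewrite ler_norml sin_geN1 sin_le1.
have := @cross_bound _ _ C (2 * eta) C0 _ (foot_bound wi) ub.
rewrite mulr_ge0// => /(_ isT); by rewrite mulrCA mulrA.
Qed.

Lemma same_signs_of_close i (d : R) z w :
  (forall k, d <= `|lineval i z k|) ->
  (forall k, `|lineval i z k - lineval i w k| < d) -> same_signs i z w.
Proof.
move=> far cl k; have := far k; have := cl k.
rewrite ltr_norml => /andP[a b].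
have [z0 h|z0 h] := ltP 0 (lineval i z k).
  by rewrite gtr0_norm// in h; apply/esym/idP; lra.
by rewrite ler0_norm// in h; apply/esym/negbTE; rewrite -leNgt; lra.
Qed.

(** At time [k] the values of [lineval] differ by at most [(1 + 4 * C * k.+1%:R) * eta]:
    [2 * C * eta] from the direction, the rest from the offset, which gains [4 * C * eta] per hit.
    While this is below [d] all signs agree, and the next side is the same. *)
Lemma orbit_close (d eta : R) (m : nat) z w i : good Q d m z -> good Q d m w ->
  generic i z -> generic i w ->
  `|z.1 - w.1| <= eta -> `|z.2 - w.2| <= eta -> (1 + 4 * C * m%:R) * eta < d ->
  forall k : nat, (k < m)%N -> exists j,
    [/\ generic j (billiard_orbit Q z k), generic j (billiard_orbit Q w k) &
        close j (2 * eta) (eta + 2 * C * eta + k%:R * (4 * C * eta))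
          (billiard_orbit Q z k) (billiard_orbit Q w k)].
Proof.
move=> zg wg gz gw h1 h2 hd; have e0 : 0 <= eta by exact: le_trans h1.
elim=> [_|k IH km].
  exists i; split=> //; rewrite mul0r addr0.
  by have [zi _ _ _] := gz; have [wi _ _ _] := gw; exact: close_init.
have [j [gzj gwj cl]] := IH (ltnW km).
have b0 : 0 <= 2 * eta by exact: mulr_ge0.
have ss : same_signs j (billiard_orbit Q z k) (billiard_orbit Q w k).
  apply: (@same_signs_of_close _ d).
    by move=> v; exact: (good_far zg _ (ltnW km) gzj).
  move=> v; apply: le_lt_trans hd.
  apply: (le_trans (close_lineval v b0 cl)).
  have kmR : k.+1%:R <= m%:R :> R by rewrite ler_nat ltnW.
  have : k.+1%:R * (4 * C * eta) <= m%:R * (4 * C * eta).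
    by rewrite ler_wpM2r// !mulr_ge0.
  by rewrite -natr1; lra.
have [j' hz] := first_hit_exists gzj.
have hw := first_hit_stable gwj ss hz.
have zz := billiard_next_step gzj; have ww := billiard_next_step gwj.
have [l gl] := good_generic zg k.+1; have [l' gl'] := good_generic wg k.+1.
have lj (x : R * R) (y : side) : first_hit j j' x -> step Q x (billiard_next Q x) ->
    generic y (billiard_next Q x) -> y = j'.
  move=> hx sx [yi _ _ _]; have [t [_ [_ js _ _] _ _]] := step_first_hit hx sx.
  exact: on_side_inj yi js.
have el := lj _ _ hz zz gl; have el' := lj _ _ hw ww gl'.
exists j'; split; first by rewrite -el.
  by rewrite -el'.
have := close_step b0 hz hw zz ww cl; rewrite /billiard_orbit !iterS.
congr (close _ _ _ _ _); rewrite -[k.+1%:R]natr1; ring.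
Qed.

End Bounds.

Lemma vertex_bound : exists2 C : R, 0 <= C &
  forall k : side, dot (vertex Q k) (vertex Q k) <= C ^+ 2.
Proof.
have d0 (k : side) : 0 <= dot (vertex Q k) (vertex Q k).
  by rewrite /dot addr_ge0// -expr2 sqr_ge0.
(* The 1 makes the square of this bound dominate each squared norm, with no square root taken. *)
exists (1 + \sum_(k < nsides Q) dot (vertex Q k) (vertex Q k)).
  by rewrite addr_ge0// sumr_ge0.
move=> k; rewrite (bigD1 k)//=; set x := dot _ _; set S := \sum_(_ < _ | _) _.
have S0 : 0 <= S by rewrite /S sumr_ge0.
have x0 : 0 <= x := d0 k.
have : 0 <= (x + S) ^+ 2 by exact: sqr_ge0.
have -> : (1 + (x + S)) ^+ 2 = 1 + 2 * x + 2 * S + (x + S) ^+ 2 by ring.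
by lra.
Qed.

End Closeness.

(** * Measurability of sets of words *)

Section ShiftMeasurable.
Context {A : finType} (Sigma : set (nat -> A)).
Local Notation meas := (@shift_measurable A Sigma).

Lemma shift_measurable0 : meas set0.
Proof. by have [] := smallest_sigma_algebra Sigma
  [set C | exists k a, C = Sigma `&` [set x | x k = a]]. Qed.

Lemma shift_measurableD B : meas B -> meas (Sigma `\` B).
Proof. by have [_ h _] := smallest_sigma_algebra Sigma
  [set C | exists k a, C = Sigma `&` [set x | x k = a]]; exact: h. Qed.

Lemma shift_measurableU B C : meas B -> meas C -> meas (B `|` C).
Proof.
move=> mB mC; rewrite -bigcup2E.
have [_ _ h] := smallest_sigma_algebra Sigma
  [set C | exists k a, C = Sigma `&` [set x | x k = a]].
by apply: h => -[|[|k]]; [exact: mB|exact: mC|exact: shift_measurable0].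
Qed.

Lemma shift_measurableI B C : B `<=` Sigma -> meas B -> meas C -> meas (B `&` C).
Proof.
move=> BS mB mC.
have -> : B `&` C = Sigma `\` ((Sigma `\` B) `|` (Sigma `\` C)).
  apply/seteqP; split=> x.
    by move=> [Bx Cx]; split; [exact: BS|case=> -[_]; apply].
  move=> [Sx H]; split; apply: contrapT => nx; apply: H; [left|right]; by split.
by apply: shift_measurableD; apply: shift_measurableU; exact: shift_measurableD.
Qed.

Lemma shift_measurable_cylinder n (w : nat -> A) :
  meas (Sigma `&` [set x | forall k, (k < n)%N -> x k = w k]).
Proof.
elim: n => [|n IH].
  rewrite (_ : _ `&` _ = Sigma `\` set0).
    by apply: shift_measurableD; exact: shift_measurable0.
  by rewrite setD0; apply/seteqP; split=> x; [case|split].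
rewrite (_ : _ `&` _ = (Sigma `&` [set x | forall k, (k < n)%N -> x k = w k]) `&`
    (Sigma `&` [set x | x n = w n])).
  apply: shift_measurableI => //.
  by apply: sub_gen_smallest; exists n, (w n).
apply/seteqP; split=> x.
  move=> [Sx h]; split; (split; first exact: Sx).
    by move=> k kn; apply: h; rewrite ltnS ltnW.
  by apply: h; rewrite ltnS.
move=> [[Sx h] [_ e]]; split=> // k; rewrite ltnS leq_eqVlt => /predU1P[->//|]; exact: h.
Qed.

Lemma shift_measurable_words n (s : seq (n.-tuple A)) :
  meas (Sigma `&` [set x | prefix_word n x \in s]).
Proof.
elim: s => [|w s IH].
  rewrite (_ : _ `&` _ = set0); first exact: shift_measurable0.
  by apply/seteqP; split=> x // [].
have [a _|A0] := pickP (mem A); last first.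
  rewrite (_ : _ `&` _ = set0); first exact: shift_measurable0.
  by apply/seteqP; split=> x //; have := A0 (x 0%N); rewrite inE.
pose v k := nth a w k.
rewrite (_ : _ `&` _ = (Sigma `&` [set x | forall k, (k < n)%N -> x k = v k]) `|`
    (Sigma `&` [set x | prefix_word n x \in s])).
  exact: (shift_measurableU (shift_measurable_cylinder n v) IH).
have E x : prefix_word n x = w <-> forall k, (k < n)%N -> x k = v k.
  split=> [e k kn|h]; first by rewrite /v -e -(tnth_nth a _ (Ordinal kn)) tnth_mktuple.
  by apply: eq_from_tnth => i; rewrite tnth_mktuple h// /v -tnth_nth.
apply/seteqP; split=> x /=.
  by rewrite inE => -[Sx /predU1P[/E h|h]]; [left|right].
by move=> [[Sx /E h]|[Sx h]]; split=> //; rewrite inE ?h ?eqxx ?orbT.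
Qed.

End ShiftMeasurable.

Lemma hamming0 {R : realType} {A : finType} n (w : n.-tuple A) : @hamming R A n w w = 0.
Proof.
rewrite /hamming (eq_card0 (A := [pred i | tnth w i != tnth w i])) ?mul0r// => i.
by rewrite inE eqxx.
Qed.

(** Neither set is assumed measurable, as the set of points whose code lies in a given set is not
    known to be. The integral of a nonnegative function is a supremum over simple functions below
    it, and extending the domain enlarges that family. *)
Lemma ge0_le_integral_subset {d} {T : measurableType d} {R : realType}
    (mu : {measure set T -> \bar R}) (A B : set T) (f : T -> \bar R) :
  (forall x, B x -> (0 <= f x)%E) -> A `<=` B ->
  (\int[mu]_(x in A) f x <= \int[mu]_(x in B) f x)%E.
Proof.
move=> f0 AB; rewrite ge0_integralE => [|x /AB]; last exact: f0.
rewrite ge0_integralE//; apply: ereal_sup_le => _ [h hf <-]; exists h => // x.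
apply: (le_trans (hf x)); rewrite !patchE; case: ifPn => [/set_mem/AB/mem_set ->//|_].
by case: ifPn => // /set_mem/f0.
Qed.

(** * Counting words and covering by balls *)

Section Words.
Context {R : realType} (Q : polygon R).
Local Notation side := 'I_(nsides Q).
Implicit Types (z : R * R).

Definition good_words (d : R) (m : nat) : {set m.-tuple side} :=
  [set w | `[< exists z x, [/\ good Q d m z, (forall k, generic (x k) (billiard_orbit Q z k)) &
     w = prefix_word m x] >]].

Lemma good_wordsP d m w : w \in good_words d m -> exists zx : (R * R) * (nat -> side),
  [/\ good Q d m zx.1, (forall k, generic (zx.2 k) (billiard_orbit Q zx.1 k)) &
     w = prefix_word m zx.2].
Proof. by rewrite inE => /asboolP[z [x h]]; exists (z, x). Qed.

Lemma trunc_dist (h : nat) (s s' : R) : (0 < h)%N -> 0 <= s -> 0 <= s' ->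
  Num.trunc (s * h%:R) = Num.trunc (s' * h%:R) -> `|s - s'| <= h%:R^-1.
Proof.
move=> h0 s0 s'0 e; have hR : 0 < h%:R :> R by rewrite ltr0n.
have /truncn_itv/andP[a b] : 0 <= s * h%:R by rewrite mulr_ge0.
have /truncn_itv/andP[a' b'] : 0 <= s' * h%:R by rewrite mulr_ge0.
rewrite e -natr1 in a b; rewrite -natr1 in b'.
rewrite -[leRHS]mul1r ler_pdivlMr// -(gtr0_norm hR) -normrM.
by rewrite ler_norml mulrBl; apply/andP; split; lra.
Qed.

(** A representative of each word is located by its side and its cell in a grid of mesh [1 / h] in
    arc length and angle, [P] bounding both ranges. By [orbit_close] with [eta = 1 / h],
    representatives in the same cell have the same word. *)
Lemma card_good_words (C d : R) (P h m : nat) : 0 <= C ->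
  (forall k : side, dot (vertex Q k) (vertex Q k) <= C ^+ 2) ->
  perimeter Q <= P%:R -> pi <= P%:R :> R -> (0 < h)%N -> (0 < m)%N ->
  (1 + 4 * C * m%:R) / h%:R < d ->
  (#|good_words d m| <= nsides Q * ((P * h).+1 * (P * h).+1))%N.
Proof.
move=> C0 hC hP hpi h0 m0 hd.
have n0 : (0 < nsides Q)%N by exact: ltn_trans (nsides_ge3 Q).
have [g gP] : exists g : m.-tuple side -> (R * R) * (nat -> side),
    forall w, w \in good_words d m ->
    [/\ good Q d m (g w).1, (forall k, generic ((g w).2 k) (billiard_orbit Q (g w).1 k)) &
     w = prefix_word m (g w).2].
  suff /choice[g gP] : forall w, exists zx : (R * R) * (nat -> side),
      w \in good_words d m -> [/\ good Q d m zx.1,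
      (forall k, generic (zx.2 k) (billiard_orbit Q zx.1 k)) & w = prefix_word m zx.2].
    by exists g.
  move=> w; have [/good_wordsP[zx H]|nw] := boolP (w \in good_words d m).
    by exists zx.
  (* A dummy value for the words that are not good. *)
  by exists ((0, 0), fun=> Ordinal n0).
pose box w : side * ('I_(P * h).+1 * 'I_(P * h).+1) :=
  ((g w).2 0%N, (inord (Num.trunc ((g w).1.1 * h%:R)), inord (Num.trunc ((g w).1.2 * h%:R)))).
rewrite -(@card_in_imset _ _ box).
  by apply: (leq_trans (max_card _)); rewrite !card_prod !card_ord.
move=> w w' /gP[zg gx wE] /gP[zg' gx' wE'].
move: zg gx wE zg' gx' wE'; rewrite /box; case: (g w) (g w') => [z x] [z' x'] /=.
move=> zg gx wE zg' gx' wE' [e0 e1 e2].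
have [zi /andP[zt0 ztp] _ _] := gx 0%N; have [zi' /andP[zt0' ztp'] _ _] := gx' 0%N.
rewrite /billiard_orbit/= in zi zt0 ztp zi' zt0' ztp'.
have /andP[s0 sP] := on_side_perimeter zi; have /andP[s0' sP'] := on_side_perimeter zi'.
have hR : 0 < h%:R :> R by rewrite ltr0n.
have T1 (s : R) : 0 < s -> s < perimeter Q -> (Num.trunc (s * h%:R) < (P * h).+1)%N.
  move=> a b; rewrite ltnS; apply/ltnW; rewrite truncn_lt_nat ?natrM ?mulr_ge0 ?ltW//.
  by rewrite ltr_pM2r// (lt_le_trans b).
have T2 (s : R) : 0 < s -> s < pi -> (Num.trunc (s * h%:R) < (P * h).+1)%N.
  move=> a b; rewrite ltnS; apply/ltnW; rewrite truncn_lt_nat ?natrM ?mulr_ge0 ?ltW//.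
  by rewrite ltr_pM2r// (lt_le_trans b).
have E1 : Num.trunc (z.1 * h%:R) = Num.trunc (z'.1 * h%:R).
  by move/(congr1 val): e1; rewrite /= !inordK//; exact: T1.
have E2 : Num.trunc (z.2 * h%:R) = Num.trunc (z'.2 * h%:R).
  by move/(congr1 val): e2; rewrite /= !inordK//; exact: T2.
have d1 := trunc_dist h0 (ltW s0) (ltW s0') E1.
have d2 := trunc_dist h0 (ltW zt0) (ltW zt0') E2.
rewrite wE wE'; apply: eq_from_tnth => k; rewrite !tnth_mktuple.
have gz' : generic (x 0%N) z' by rewrite e0; exact: gx'.
have [j [[gj _ _ _] [gj' _ _ _] _]] := orbit_close C0 hC zg zg' (gx 0%N) gz' d1 d2 hd (ltn_ord k).
have [gk _ _ _] := gx k; have [gk' _ _ _] := gx' k.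
by rewrite (on_side_inj gk gj) (on_side_inj gk' gj').
Qed.

(** The balls are centred at codes of good points, and each is used only for the sequences that
    share its prefix, at Hamming distance 0. The size of [eps] thus matters only for the measure
    left uncovered. *)
Lemma good_words_coverable (d eps : R) (m : nat) : 0 < eps ->
  (((1 - eps)%:E * liouville Q (phase_space Q)) <= liouville Q (good Q d m))%E ->
  ball_coverable (billiard_shift Q) (billiard_shift_measure Q) m eps #|good_words d m|.
Proof.
move=> e0 H; pose B : set (nat -> side) :=
  billiard_shift Q `&` [set x | prefix_word m x \in enum (good_words d m)].
have [c cP] : exists c : 'I_#|good_words d m| -> (nat -> side), forall i,
    billiard_shift Q (c i) /\ prefix_word m (c i) = enum_val i.
  suff /choice[c cP] : forall i : 'I_#|good_words d m|, exists x,
      billiard_shift Q x /\ prefix_word m x = enum_val i by exists c.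
  move=> i; have /good_wordsP[[z x] [/= zg gx wE]] := enum_valP i.
  by exists x; split=> //; exists z; exact: is_code_orbit.
exists B, c; split.
- exact: shift_measurable_words.
- rewrite /billiard_shift_measure.
  have M0 := liouville_phase_space_gt0 Q; have M1 := liouville_phase_space_lty Q.
  have Mfin : liouville Q (phase_space Q) \is a fin_num.
    by rewrite ge0_fin_numE// ltW.
  move: H M0; rewrite -(fineK Mfin) lte_fin => H M0.
  rewrite inver gt_eqF// lee_pdivlMr//; apply: (le_trans H).
  apply: ge0_le_integral_subset; first by move=> z [_ [_ /sin_gt0_pi/ltW]]; rewrite lee_fin.
  move=> z [zg zp]; split=> //; have [x gx] := good_code zg.
  have zx := is_code_orbit gx; exists x => //; split; first by exists z.
  by rewrite /= mem_enum inE; apply/asboolP; exists z, x.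
- by move=> i; have [] := cP i.
- move=> x [Sx]; rewrite /= mem_enum => xW.
  exists (enum_rank_in xW (prefix_word m x)) => //; split=> //.
  by have [_ ->] := cP (enum_rank_in xW (prefix_word m x)); rewrite enum_rankK_in// hamming0.
Qed.

End Words.

(** Two scales are fixed. With [d = 1 / (J * m)] and [J] large, the bad set, of measure at most
    [m * (n ^ 2 * (2 * d * pi))], has measure at most [eps * M]. With mesh [1 / (h0 * m ^ 2)], the
    divergence up to time [m] is at most [(1 + 4 * C) / (h0 * m)], which is below [d] by the choice
    of [h0]. *)
Lemma billiard_metric_complexity_le {R : realType} (Q : polygon R) (eps : R) : 0 < eps ->
  exists K : nat, forall m, (0 < m)%N ->
    (metric_complexity (billiard_shift Q) (billiard_shift_measure Q) m eps
       <= ((K * m ^ 4)%N%:R)%:E)%E.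
Proof.
move=> e0; set n := nsides Q.
have M0 := liouville_phase_space_gt0 Q; have M1 := liouville_phase_space_lty Q.
have Mfin : liouville Q (phase_space Q) \is a fin_num by rewrite ge0_fin_numE// ltW.
set M := fine (liouville Q (phase_space Q)).
have ME : liouville Q (phase_space Q) = M%:E by rewrite fineK.
have {}M0 : 0 < M by rewrite -lte_fin -ME.
have [C C0 hC] := vertex_bound Q.
pose J := (Num.trunc (n%:R ^+ 2 * (2 * pi) / (eps * M))).+1.
pose h0 := (Num.trunc ((1 + 4 * C) * J%:R)).+1.
pose P := (Num.trunc (perimeter Q + pi)).+1.
have JP : n%:R ^+ 2 * (2 * pi) / (eps * M) < J%:R by exact: truncnS_gt.
have hP : (1 + 4 * C) * J%:R < h0%:R by exact: truncnS_gt.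
have PP : perimeter Q + pi < P%:R by exact: truncnS_gt.
have J0 : 0 < J%:R :> R by rewrite ltr0n.
have h00 : 0 < h0%:R :> R by rewrite ltr0n.
have eM0 : 0 < eps * M by exact: mulr_gt0.
exists (n * (P * h0).+1 ^ 2)%N => m m0.
have mR : 1 <= m%:R :> R by rewrite ler1n.
have mR0 : 0 < m%:R :> R by exact: lt_le_trans mR.
pose d : R := (J%:R * m%:R)^-1.
have d0 : 0 < d by rewrite invr_gt0 mulr_gt0.
have cov : ball_coverable (billiard_shift Q) (billiard_shift_measure Q) m eps #|good_words Q d m|.
  apply: good_words_coverable => //.
  have := liouville_good Q m d0.
  have mP := measurable_phase_space Q; have mG := measurable_good Q d m.
  have Gfin : liouville Q (good Q d m) \is a fin_num.
    rewrite ge0_fin_numE ?measure_ge0//; apply: le_lt_trans M1.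
    by apply: le_measure; rewrite ?inE// => z [].
  rewrite ME -(fineK Gfin) -EFinD !lee_fin mulrBl mul1r => H.
  have : m%:R * (n%:R ^+ 2 * (2 * d * pi)) <= eps * M.
    have -> : m%:R * (n%:R ^+ 2 * (2 * d * pi)) = n%:R ^+ 2 * (2 * pi) / J%:R.
      by rewrite /d; field; rewrite !gt_eqF.
    by rewrite ler_pdivrMr// [leRHS]mulrC -ler_pdivrMr// ltW.
  by move: H; rewrite -/n; lra.
have hm0 : (0 < h0 * m ^ 2)%N by rewrite muln_gt0 expn_gt0 m0.
have hd : (1 + 4 * C * m%:R) / (h0 * m ^ 2)%N%:R < d.
  rewrite /d ltr_pdivrMr ?ltr0n// [X in _ < X]mulrC ltr_pdivlMr ?mulr_gt0// natrM natrX.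
  apply: (@le_lt_trans _ _ ((1 + 4 * C) * J%:R * m%:R ^+ 2)); last first.
    by rewrite ltr_pM2r ?exprn_gt0//.
  have -> : (1 + 4 * C) * J%:R * m%:R ^+ 2 =
    (1 * m%:R + 4 * C * m%:R) * (J%:R * m%:R) :> R by ring.
  by rewrite ler_pM2r ?mulr_gt0// lerD2r mul1r.
have per0 := perimeter_gt0 Q; have pi0 := pi_gt0 R.
have cardW : (#|good_words Q d m| <= n * ((P * (h0 * m ^ 2)).+1 * (P * (h0 * m ^ 2)).+1))%N.
  by apply: (card_good_words C0 hC) => //; lra.
apply: (@le_trans _ _ (#|good_words Q d m|%:R)%:E).
  by apply: ereal_inf_lbound; exists #|good_words Q d m|.
rewrite lee_fin ler_nat; apply: (leq_trans cardW).
(* Since [1 <= m ^ 2], the extra cell in each coordinate is absorbed into [K]. *)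
have hA : ((P * (h0 * m ^ 2)).+1 <= (P * h0).+1 * m ^ 2)%N.
  by rewrite mulSn mulnA -add1n leq_add2r expn_gt0 m0.
rewrite -mulnA leq_mul2l (_ : (_ * m ^ 4 = (P * h0).+1 * m ^ 2 * ((P * h0).+1 * m ^ 2))%N).
  by rewrite leq_mul ?orbT.
by rewrite mulnn expnMn -expnM.
Qed.

Theorem corollary4 (R : realType) (Q : polygon R) (f : nat -> nat)
    (f_nondecreasing : {homo f : m n / (m <= n)%N})
    (f_gt0 : forall n, (0 < n)%N -> (0 < f n)%N)
    (f_summable : cvgn (series (fun n => (((n.+1 * f n.+1)%N)%:R : R)^-1))) :
  upper_metric_complexity_le (billiard_shift Q) (billiard_shift_measure Q)
    (fun n => (n ^ 6 * f n ^ 2)%N).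
Proof.
(* For every fixed [eps > 0] the upper limit in [n] is already 0, hence so is the limit in [eps]. *)
exists 0%E => //.
apply: cvg_near_cst; near=> eps.
have e0 : 0 < eps by near: eps; exact: nbhs_right_gt.
have [K hK] := billiard_metric_complexity_le Q e0.
set u := fun n => _.
suff u0 : u n @[n --> \oo] --> 0%E.
  by rewrite is_cvg_limn_esupE; [exact: cvg_lim|apply/cvg_ex; exists 0%E].
(* As [harmonic n] is [1 / (n + 1)], the factor 2 pays for the shift: [n + 1 <= 2 * n ^ 2 * f n ^ 2]
   for positive [n]. *)
apply: (@squeeze_cvge _ _ _ _ (cst 0%E) u (fun n => (2 * K%:R * harmonic n)%:E)); last 2 first.
- exact: cvg_cst.
- have h : (2 * K%:R * harmonic n : R) @[n --> \oo] --> (2 * K%:R * 0 : R).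
    by apply: cvgM; [exact: cvg_cst|exact: cvg_harmonic].
  by rewrite mulr0 in h; apply: cvg_EFin => //; near=> n.
near=> n; have n0 : (0 < n)%N by near: n; exact: nbhs_infty_gt.
have g0 : (0 < (n ^ 6 * f n ^ 2)%N%:R :> R).
  by rewrite ltr0n muln_gt0 !expn_gt0 n0 f_gt0.
have c0 : (0 <= metric_complexity (billiard_shift Q) (billiard_shift_measure Q) n eps)%E.
  by apply/ereal_infP => _ [N _ <-]; rewrite lee_fin.
rewrite /u inver gt_eqF//; apply/andP; split.
  by rewrite mule_ge0// lee_fin invr_ge0 ltW.
rewrite lee_pdivrMr//; apply: (le_trans (hK n n0)).
rewrite -EFinM lee_fin /harmonic.
have nR : 1 <= n%:R :> R by rewrite ler1n.
have fR : 1 <= (f n)%:R :> R by rewrite ler1n f_gt0.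
have -> : (K * n ^ 4)%N%:R = K%:R * n%:R ^+ 4 :> R by rewrite natrM natrX.
have -> : (n ^ 6 * f n ^ 2)%N%:R = n%:R ^+ 6 * (f n)%:R ^+ 2 :> R by rewrite natrM !natrX.
rewrite [X in _ <= X]mulrAC ler_pdivlMr ?ltr0n// -natr1.
have -> : 2 * K%:R * (n%:R ^+ 6 * (f n)%:R ^+ 2) =
  K%:R * n%:R ^+ 4 * (2 * n%:R ^+ 2 * (f n)%:R ^+ 2) :> R by ring.
apply: ler_wpM2l; first by rewrite mulr_ge0// exprn_ge0.
have n2 : n%:R <= n%:R ^+ 2 :> R by rewrite expr2 ler_peMr// (le_trans ler01).
have f2 : 1 <= (f n)%:R ^+ 2 :> R by exact: exprn_ege1.
have : 2 * n%:R ^+ 2 <= 2 * n%:R ^+ 2 * (f n)%:R ^+ 2 :> R.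
  by rewrite ler_peMr// mulr_ge0// exprn_ge0.
by lra.
Unshelve. all: by end_near. Qed.
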